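(* Let $R$ be a commutative Noetherian ring, $\mathfrak{a}$ an ideal of $R$ and $M$ a finitely generated $R$-module of finite dimension $d$. Then $$\operatorname{Att}_RH^d_{\mathfrak{a}}(M)=\{\mathfrak{p}\in\operatorname{Assh}_RM:\operatorname{cd}_R(\mathfrak{a},R/\mathfrak{p})=d\}.$$
   Context: Rings are commutative Noetherian, not necessarily local. $H^i_{\mathfrak{a}}(-)$ denotes the $i$-th local cohomology functor with respect to $\mathfrak{a}$. $\operatorname{Assh}_RM$ is the set of associated primes $\mathfrak{p}$ of $M$ with $\dim R/\mathfrak{p}=\dim M$. The cohomological dimension is $\operatorname{cd}_R(\mathfrak{a},N):=\sup\{i\in\mathbb{N}_0:H^i_{\mathfrak{a}}(N)\neq0\}$ (with $\sup\emptyset=-\infty$). A nonzero $R$-module $S$ is secondary if for each $x\in R$ multiplication by $x$ on $S$ is either surjective or nilpotent; then $\mathfrak{p}=\operatorname{Rad}(\operatorname{Ann}_RS)$ is prime. A module is representable if it is a finite sum $S_1+\dots+S_n$ of secondary submodules; one may choose this minimal, i.e. the primes $\mathfrak{p}_i=\operatorname{Rad}(\operatorname{Ann}_RS_i)$ are distinct and $S_j\nsubseteq\sum_{i\neq j}S_i$ for all $j$. The set $\{\mathfrak{p}_1,\dots,\mathfrak{p}_n\}$ is then independent of the minimal representation and is denoted $\operatorname{Att}_R$ of the module (the attached primes). Artinian modules are representable, and $H^d_{\mathfrak{a}}(M)$ with $d=\dim M$ is known to be Artinian. *)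

(* Defs.v *)
From HB Require Import structures.
From mathcomp Require Import all_boot all_order all_algebra ring_quotient.
From mathcomp Require Import generic_quotient.
From mathcomp Require Import boolp classical_sets functions constructive_ereal.
Set Implicit Arguments.
Unset Strict Implicit.
Unset Printing Implicit Defensive.
Import GRing.Theory Num.Theory.
Local Open Scope classical_set_scope.
Local Open Scope ring_scope.
Local Open Scope quotient_scope.

Record submod (R : comNzRingType) (V : lmodType R) := Submod {
  submod_pred :> {pred V};
  submod_closedP : submod_closed submod_pred }.

Lemma submod_subproof (R : comNzRingType) (V : lmodType R) (W : submod V) :
  GRing.subsemimod_closed (submod_pred W).
Proof. exact/GRing.submod_closed_semi/submod_closedP. Qed.

HB.instance Definition _ (R : comNzRingType) (V : lmodType R) (W : submod V) :=
  GRing.isSubmodClosed.Build R V (submod_pred W) (submod_subproof W).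

Definition submod_of (R : comNzRingType) (V : lmodType R) (W : submod V) : Type :=
  {x : V | x \in submod_pred W}.

Section SubmodOf.
Context (R : comNzRingType) (V : lmodType R) (W : submod V).
HB.instance Definition _ := [isSub of submod_of W for @sval _ _].
HB.instance Definition _ := [Choice of submod_of W by <:].
HB.instance Definition _ := [SubChoice_isSubLmodule of submod_of W by <:].
End SubmodOf.

Definition quotmod (R : comNzRingType) (V : lmodType R) (W : submod V) : Type :=
  Quotient.quot (submod_pred W).

Section Quotmod.
Context (R : comNzRingType) (V : lmodType R) (W : submod V).
HB.instance Definition _ := GRing.Zmodule.on (quotmod W).
HB.instance Definition _ := EqQuotient.on (quotmod W).

Definition quotmod_pi (x : V) : quotmod W := \pi_(Quotient.quot (submod_pred W)) x.
Definition quotmod_scale (c : R) (x : quotmod W) : quotmod W :=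
  quotmod_pi (c *: (repr (x : Quotient.quot (submod_pred W)))).

Lemma quotmod_piP x y : (quotmod_pi x = quotmod_pi y) <-> x - y \in submod_pred W.
Proof. by rewrite Quotient.idealrBE; split => [/eqP//|/eqP]. Qed.

Lemma quotmod_ind (P : quotmod W -> Prop) : (forall x, P (quotmod_pi x)) -> forall x, P x.
Proof. by move=> H x; rewrite -[x]reprK; exact: H. Qed.

Lemma quotmod_piD x y : quotmod_pi (x + y) = quotmod_pi x + quotmod_pi y.
Proof. exact: (raddfD (\pi_(Quotient.quot (submod_pred W)))). Qed.

Lemma quotmod_piZ c x : quotmod_scale c (quotmod_pi x) = quotmod_pi (c *: x).
Proof.
apply/quotmod_piP; rewrite -scalerBr rpredZ //; apply/quotmod_piP.
exact: reprK.
Qed.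

Lemma quotmod_scaleA a b x :
  quotmod_scale a (quotmod_scale b x) = quotmod_scale (a * b) x.
Proof. by elim/quotmod_ind: x => x; rewrite !quotmod_piZ scalerA. Qed.
Lemma quotmod_scale1 : left_id 1 quotmod_scale.
Proof. by elim/quotmod_ind => x; rewrite quotmod_piZ scale1r. Qed.
Lemma quotmod_scaleDr : right_distributive quotmod_scale +%R.
Proof.
move=> a; elim/quotmod_ind => x; elim/quotmod_ind => y.
by rewrite -quotmod_piD !quotmod_piZ scalerDr quotmod_piD.
Qed.
Lemma quotmod_scaleDl x : {morph quotmod_scale^~ x : a b / a + b}.
Proof.
move=> a b; elim/quotmod_ind: x => x.
by rewrite !quotmod_piZ scalerDl quotmod_piD.
Qed.
HB.instance Definition _ := GRing.Zmodule_isLmodule.Build R (quotmod W)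
  quotmod_scaleA quotmod_scale1 quotmod_scaleDr quotmod_scaleDl.

Lemma quotmod_pi_is_linear : linear quotmod_pi.
Proof. by move=> a x y; rewrite quotmod_piD -quotmod_piZ. Qed.
HB.instance Definition _ := GRing.isLinear.Build R V (quotmod W) *:%R quotmod_pi
  quotmod_pi_is_linear.
End Quotmod.

Section SubmodConstructions.
Context (R : comNzRingType).
Implicit Types U V : lmodType R.

Lemma kermod_closed U V (f : {linear U -> V}) :
  submod_closed [pred x : U | f x == 0].
Proof.
split=> [|a x y]; rewrite !inE ?linear0 // => /eqP fx /eqP fy.
by rewrite linearP fx fy scaler0 addr0.
Qed.
Definition kermod U V (f : {linear U -> V}) : submod U := Submod (kermod_closed f).

Lemma immod_closed U V (f : {linear U -> V}) :
  submod_closed [pred y : V | `[< exists x, f x = y >]].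
Proof.
split=> [|a y y']; first by apply/asboolP; exists 0; rewrite linear0.
move=> /asboolP[x <-] /asboolP[x' <-].
by apply/asboolP; exists (a *: x + x'); rewrite linearP.
Qed.
Definition immod U V (f : {linear U -> V}) : submod V := Submod (immod_closed f).

Lemma zeromod_closed V : submod_closed [pred x : V | x == 0].
Proof.
split=> [|a x y]; rewrite !inE // => /eqP-> /eqP->.
by rewrite scaler0 addr0.
Qed.
Definition zeromod V : submod V := Submod (@zeromod_closed V).

Lemma fullmod_closed V : submod_closed [pred _ : V | true].
Proof. by split. Qed.
Definition fullmod V : submod V := Submod (@fullmod_closed V).

Lemma restrmod_closed V (W W' : submod V) :
  submod_closed [pred x : submod_of W | val x \in W'].
Proof.
split=> [|a x y Wx Wy]; first by rewrite inE raddf0 rpred0.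
by rewrite inE linearP /= rpredD // rpredZ.
Qed.
(* the trace on [W] of the submodule [W'] of the ambient module *)
Definition restrmod V (W W' : submod V) : submod (submod_of W) :=
  Submod (restrmod_closed W W').

Lemma spanmod_closed V (A : set V) :
  submod_closed [pred x : V |
    `[< forall W : submod V, (forall y, A y -> y \in W) -> x \in W >]].
Proof.
split=> [|a x y /asboolP xA /asboolP yA]; apply/asboolP => W AW.
  exact: rpred0.
by rewrite rpredD ?rpredZ ?xA ?yA.
Qed.
Definition spanmod V (A : set V) : submod V := Submod (spanmod_closed A).

Definition nonzero_module V := exists x : V, x != 0.

Definition finitely_generated V :=
  exists s : seq V, forall x : V, x \in spanmod [set` s].

End SubmodConstructions.

Notation ideal R := (submod R^o).

Section Ideals.
Context (R : comNzRingType).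
Implicit Types (I J p : ideal R) (V : lmodType R).

Definition noetherian := forall I, finitely_generated (submod_of I).

Definition prime_ideal p := 1 \notin p /\ prime_idealr_closed p.

Definition ideal_mul I J : ideal R :=
  spanmod [set z : R^o | exists x y : R, [/\ x \in I, y \in J & z = x * y]].

Definition ideal_exp I n : ideal R := iter n (ideal_mul I) (fullmod R^o).

Lemma ideal_mulr_closed I (c x : R) : x \in I -> c * x \in I.
Proof. exact: (@rpredZ R R^o I c x). Qed.

Lemma radical_closed I :
  submod_closed [pred x : R^o | `[< exists n, (x : R) ^+ n \in I >]].
Proof.
split=> [|a x y /asboolP[m xm] /asboolP[n yn]].
  by apply/asboolP; exists 1%N; rewrite expr1; apply: (rpred0 I).
apply/asboolP; exists (m + n)%N.
rewrite (exprDn (a * (x : R)) y); apply: (@rpred_sum _ I) => i _.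
apply: (@rpredMn _ I); case: (leqP i n) => lin.
  rewrite -addnBA // exprD exprMn mulrC !mulrA.
  by rewrite mulrAC; apply: ideal_mulr_closed.
by rewrite -(subnK (ltnW lin)) exprD mulrA ideal_mulr_closed.
Qed.
Definition radical I : ideal R := Submod (radical_closed I).

Lemma annihilator_closed V :
  submod_closed [pred c : R^o | `[< forall x : V, (c : R) *: x = 0 >]].
Proof.
split=> [|a b c /asboolP b0 /asboolP c0]; apply/asboolP => x.
  exact: scale0r.
by rewrite scalerDl -scalerA b0 c0 scaler0 addr0.
Qed.
Definition annihilator V : ideal R := Submod (annihilator_closed V).

Lemma elt_annihilator_closed V (x : V) :
  submod_closed [pred c : R^o | (c : R) *: x == 0].
Proof.
split=> [|a b c]; rewrite !inE ?scale0r // => /eqP b0 /eqP c0.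
by rewrite scalerDl -scalerA b0 c0 scaler0 addr0.
Qed.
Definition elt_annihilator V (x : V) : ideal R :=
  Submod (elt_annihilator_closed x).

(* supremum in {-oo} U nat U {+oo} *)
Definition nat_sup (A : set nat) : \bar nat :=
  if `[< A = set0 >] then -oo%E
  else xget +oo%E [set n%:E%E | n in [set n | A n /\ forall m, A m -> (m <= n)%N]].

Definition prime_chain_length I : set nat :=
  [set n | exists p : nat -> ideal R,
    (forall i, (i <= n)%N -> prime_ideal (p i) /\ {subset I <= p i}) /\
    (forall i, (i < n)%N ->
       {subset p i <= p i.+1} /\ ~ {subset p i.+1 <= p i})].

(* Krull dimension of the ring [R / I], read off the primes of [R] over [I] *)
Definition dim_quot I : \bar nat := nat_sup (prime_chain_length I).

Definition dim_module V : \bar nat := dim_quot (annihilator V).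

Definition Ass V : set (ideal R) :=
  [set p | prime_ideal p /\ exists x : V, p = elt_annihilator x].

Definition Assh V : set (ideal R) :=
  [set p | Ass V p /\ dim_quot p = dim_module V].

End Ideals.

Section AttachedPrimes.
Context (R : comNzRingType).
Implicit Types V : lmodType R.

Definition secondary V :=
  nonzero_module V /\
  forall c : R, (forall y : V, exists x : V, c *: x = y) \/
                (exists n, forall x : V, c ^+ n *: x = 0).

Definition sum_submod V n (P : pred 'I_n) (S : 'I_n -> submod V) : submod V :=
  spanmod (\bigcup_(i in [set i | P i]) [set x | x \in S i]).

Definition attached_prime V (S : submod V) : ideal R :=
  radical (annihilator (submod_of S)).

Definition minimal_secondary_representation V n (S : 'I_n -> submod V) :=
  [/\ forall i, secondary (submod_of (S i)),
      forall x : V, x \in sum_submod predT S,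
      injective (fun i => attached_prime (S i)) &
      forall j, ~ {subset S j <= sum_submod (predC1 j) S}].

(* These primes do not depend on the minimal representation, so that an
   existential quantifier over representations is enough. *)
Definition Att V : set (ideal R) :=
  [set p | exists n (S : 'I_n -> submod V),
     minimal_secondary_representation S /\ exists i, p = attached_prime (S i)].

End AttachedPrimes.

Section Torsion.
Context (R : comNzRingType) (a : ideal R).
Implicit Types U V : lmodType R.

Lemma torsion_closed V :
  submod_closed [pred x : V | `[< exists n,
    forall c : R, c \in ideal_exp a n -> c *: x = 0 >]].
Proof.
have anti n m : {subset ideal_exp a (m + n) <= ideal_exp a n}.
  elim: m => // m IH x /asboolP xspan; apply: IH.
  apply: xspan => _ [y [z [_ zI ->]]]; exact: ideal_mulr_closed.
split=> [|c x y /asboolP[m xm] /asboolP[n yn]]; apply/asboolP.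
  by exists 0%N => c _; rewrite scaler0.
exists (m + n)%N => b bI; rewrite scalerDr scalerA mulrC -scalerA.
rewrite xm ?yn ?scaler0 ?addr0 //; first exact: anti bI.
by move: bI; rewrite addnC; apply: anti.
Qed.
Definition torsion V : submod V := Submod (torsion_closed V).

Lemma torsion_map_subproof U V (f : {linear U -> V}) (x : submod_of (torsion U)) :
  f (val x) \in torsion V.
Proof.
have /asboolP[n xn] := valP x; apply/asboolP; exists n => c cI.
by rewrite -linearZ xn // linear0.
Qed.
Definition torsion_map U V (f : {linear U -> V}) (x : submod_of (torsion U)) :
  submod_of (torsion V) := Sub (f (val x)) (torsion_map_subproof f x).

Lemma torsion_map_is_linear U V (f : {linear U -> V}) : linear (torsion_map f).
Proof. by move=> c x y; apply: val_inj; rewrite /= !linearP. Qed.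
HB.instance Definition _ U V (f : {linear U -> V}) :=
  GRing.isLinear.Build R _ _ *:%R (torsion_map f) (torsion_map_is_linear f).
End Torsion.
Arguments torsion_map {R} a {U V} f x.

Record cochain_complex (R : comNzRingType) := CochainComplex {
  cx_obj :> nat -> lmodType R;
  cx_diff : forall n, {linear cx_obj n -> cx_obj n.+1};
  cx_diffK : forall n x, cx_diff n.+1 (cx_diff n x) = 0 }.

Section Complexes.
Context (R : comNzRingType).

Definition coboundaries (C : cochain_complex R) n : submod (C n) :=
  match n with 0 => zeromod (C 0) | m.+1 => immod (cx_diff C m) end.

Definition cohomology (C : cochain_complex R) n : lmodType R :=
  quotmod (restrmod (kermod (cx_diff C n)) (coboundaries C n)).

Lemma torsion_complex_subproof (a : ideal R) (C : cochain_complex R) n x :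
  torsion_map a (cx_diff C n.+1) (torsion_map a (cx_diff C n) x) = 0.
Proof. by apply: val_inj; rewrite /= cx_diffK. Qed.
Definition torsion_complex (a : ideal R) (C : cochain_complex R) :=
  @CochainComplex R (fun n => submod_of (torsion a (C n)))
    (fun n => torsion_map a (cx_diff C n)) (@torsion_complex_subproof a C).

Definition injective_module (E : lmodType R) :=
  forall (U V : lmodType R) (f : {linear U -> V}) (g : {linear U -> E}),
    injective f -> exists h : {linear V -> E}, forall x, h (f x) = g x.

Record injective_resolution (M : lmodType R) := InjectiveResolution {
  res_complex :> cochain_complex R;
  res_aug : {linear M -> res_complex 0};
  res_injective : forall n, injective_module (res_complex n);
  res_aug_inj : injective res_aug;
  res_exact0 : forall x, cx_diff res_complex 0 x = 0 <-> exists y, res_aug y = x;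
  res_exact : forall n x, cx_diff res_complex n.+1 x = 0 ->
    exists y, cx_diff res_complex n y = x }.

End Complexes.

Definition divisible (D : zmodType) :=
  forall n (d : D), (0 < n)%N -> exists e : D, e *+ n = d.

Section AdditiveExtension.
Context (B D : zmodType).
Implicit Type G : set (B * D).

Definition additive_graph G :=
  [/\ G 0, forall u v, G u -> G v -> G (u - v) & forall d, G (0, d) -> d = 0].

Lemma additive_graphN G u : additive_graph G -> G u -> G (- u).
Proof. by case=> G0 GB _ Gu; rewrite -sub0r; apply: GB. Qed.

Lemma additive_graphD G u v : additive_graph G -> G u -> G v -> G (u + v).
Proof.
by move=> gG Gu Gv; rewrite -[v]opprK; case: (gG) => _ + _; apply=> //; apply: additive_graphN.
Qed.

Lemma additive_graphMn G b d n : additive_graph G -> G (b, d) -> G (b *+ n, d *+ n).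
Proof.
move=> gG Gu; elim: n => [|n IH]; first by case: gG.
by rewrite !mulrS; apply: (@additive_graphD G (b, d) (b *+ n, d *+ n)).
Qed.

Lemma additive_graph_fun G b d d' :
  additive_graph G -> G (b, d) -> G (b, d') -> d = d'.
Proof.
case=> _ GB Gf /GB /[apply]; rewrite (_ : _ - _ = (0, d - d')).
  by move=> /Gf/eqP; rewrite subr_eq0 => /eqP.
by congr pair; rewrite subrr.
Qed.

Lemma additive_graph_value G b : divisible D -> additive_graph G ->
  exists d, forall k c, G (b *+ k, c) -> c = d *+ k.
Proof.
move=> divD gG; have [_ _ Gf] := gG.
pose S n := `[< (0 < n)%N /\ exists c, G (b *+ n, c) >].
have [[n0 Sn0]|noS] := pselect (exists n, S n); last first.
  exists 0 => -[|k] c Gc; first by apply: Gf.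
  by case: noS; exists k.+1; apply/asboolP; split=> //; exists c.
have [n /asboolP[n_gt0 [c Gc]] n_min] := ex_minnP (ex_intro S n0 Sn0).
have [d dn] := divD n c n_gt0; exists d => k c' Gc'.
have GqN := additive_graphN gG (additive_graphMn (k %/ n) gG Gc).
have := additive_graphD gG Gc' GqN.
rewrite (_ : _ + _ = (b *+ (k %% n), c' - d *+ n *+ (k %/ n))); last first.
  congr pair; last by rewrite dn.
  by rewrite /= {1}(divn_eq k n) mulrnDr -mulrnA mulnC addrAC subrr add0r.
case: (posnP (k %% n)) => [r0|r_gt0] Gr.
  move: Gr; rewrite r0 mulr0n => /Gf/eqP; rewrite subr_eq0 => /eqP ->.
  by rewrite -mulrnA mulnC {2}(divn_eq k n) r0 addn0.
have : S (k %% n)%N by apply/asboolP; split=> //; eexists; exact: Gr.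
by move=> /n_min; rewrite leqNgt ltn_mod n_gt0.
Qed.

Lemma additive_graph_adjoin G b : divisible D -> additive_graph G ->
  exists2 G', additive_graph G' & G `<=` G' /\ exists d, G' (b, d).
Proof.
move=> divD gG; have [G0 GB Gf] := gG.
have [d dP] := additive_graph_value b divD gG.
exists [set u | exists k : int, G (u - (b *~ k, d *~ k))]; last first.
  split=> [u Gu|]; first by exists 0; rewrite !mulr0z subr0.
  by exists d, 1; rewrite !mulr1z subrr.
split=> [|u v [k Gu] [l Gv]|c [k]].
- by exists 0; rewrite !mulr0z subr0.
- exists (k - l); have := GB _ _ Gu Gv; congr G.
  rewrite (_ : (b *~ (k - l), d *~ (k - l)) = (b *~ k, d *~ k) - (b *~ l, d *~ l)).
    by rewrite !opprD !opprK addrACA.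
  by rewrite !mulrzBr.
- rewrite (_ : _ - _ = (- (b *~ k), c - d *~ k)); last by congr pair; rewrite sub0r.
  case: k => k Gk.
    have := additive_graphN gG Gk; rewrite (_ : - _ = (b *+ k, d *+ k - c)).
      by move=> /dP/eqP; rewrite -subr_eq0 addrAC subrr sub0r oppr_eq0 => /eqP.
    by congr pair; rewrite /= ?opprK // opprB.
  move: Gk; rewrite NegzE !mulrNz !opprK => /dP/eqP.
  by rewrite -subr_eq0 addrK => /eqP.
Qed.

Lemma additive_extension G : divisible D -> additive_graph G ->
  exists h : {additive B -> D}, forall b d, G (b, d) -> h b = d.
Proof.
move=> divD gG.
have [F Fsub Ftot|A [gA Amax]] :=
    @Zorn_bigcup _ (fun X => additive_graph (X `|` G)).
  have GF u : (\bigcup_(X in F) X `|` G) u ->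
      exists Y, [/\ additive_graph Y, Y u,
        Y `<=` \bigcup_(X in F) X `|` G & Y = G \/ exists2 X, F X & Y = X `|` G].
    move=> [[X FX Xu]|Gu]; last by exists G; split=> //; left.
    exists (X `|` G); split; [exact: Fsub| by left | |by right; exists X].
    by apply: setSU => x Xx; exists X.
  split=> [|u v|d /GF[Y [[_ _ Yf] /Yf -> _ _]]] //; first by right; case: gG.
  move=> /GF[Y [gY Yu YF Yc]] /GF[Z [gZ Zv ZF Zc]].
  suff [YZ|ZY] : Y `<=` Z \/ Z `<=` Y.
  - by apply: ZF; case: gZ => _ + _; apply=> //; apply: YZ.
  - by apply: YF; case: gY => _ + _; apply=> //; apply: ZY.
  case: Yc => [->|[X FX ->]]; case: Zc => [->|[X' FX' ->]]; first by left.
  + by left=> x; right.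
  + by right=> x; right.
  + by case: (Ftot X X' FX FX') => XX; [left|right]; apply: setSU.
have tot b : exists d, (A `|` G) (b, d).
  have [G' gG' [sG' [d G'd]]] := additive_graph_adjoin b divD gA.
  exists d; apply: contrapT => nd; apply: (Amax G').
    split=> [x Ax|/(_ _ G'd) Ad]; first by apply: sG'; left.
    by apply: nd; left.
  suff -> : G' `|` G = G' by [].
  by apply/setUidPl => x Gx; apply: sG'; right.
have [h hP] := choice tot.
have hZ : zmod_morphism h.
  move=> x y; apply: (additive_graph_fun gA (hP _)).
  by case: gA => _ /(_ _ _ (hP x) (hP y)).
pose hh := GRing.isZmodMorphism.Build _ _ h hZ.
pose h' : {additive B -> D} := HB.pack h hh.
exists h' => b d Gd; apply: (additive_graph_fun gA (hP b)); by right.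
Qed.

End AdditiveExtension.

Section RationalsModIntegers.

Definition ratZ : {pred rat} := [pred x | x \is a Num.int].
Lemma ratZ_closed : zmod_closed ratZ.
Proof. by split=> [|x y]; rewrite !inE ?rpred0 // => xZ yZ; rewrite rpredB. Qed.
HB.instance Definition _ := GRing.isZmodClosed.Build rat ratZ ratZ_closed.

(* The group QmodZ is an injective cogenerator of abelian groups, so that
   [V |-> prod_(chi : V -> QmodZ) Hom_Z(R, QmodZ)] embeds every module into an
   injective one; iterating gives an injective resolution of every module. *)
Definition QmodZ : zmodType := Quotient.quot ratZ.

Lemma QmodZ_eq0 (x : rat) : (\pi_QmodZ x == 0 :> QmodZ) = (x \is a Num.int).
Proof.
have <- : \pi_QmodZ 0 = 0 :> QmodZ by exact: raddf0.
by rewrite -(Quotient.idealrBE ratZ) subr0.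
Qed.

Lemma QmodZ_divisible : divisible QmodZ.
Proof.
move=> n d n_gt0; rewrite -[d]reprK; move: (repr d) => x.
exists (\pi_QmodZ (x / n%:R)); rewrite -raddfMn -[_ / _ *+ _]mulr_natr divfK //.
by rewrite pnatr_eq0 -lt0n.
Qed.

Lemma QmodZ_separates (M : zmodType) (x : M) : x != 0 ->
  exists h : {additive M -> QmodZ}, h x != 0.
Proof.
move=> x0.
have [n n_gt1 nP] : exists2 n, (1 < n)%N & forall k, x *+ k = 0 -> (n %| k)%N.
  pose S n := (0 < n)%N && (x *+ n == 0).
  have [[n0 Sn0]|noS] := pselect (exists n, S n); last first.
    exists 2%N => // -[//|k] xk; case: noS; exists k.+1; by rewrite /S /= xk eqxx.
  have [n /andP[n_gt0 /eqP xn] n_min] := ex_minnP (ex_intro S n0 Sn0).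
  exists n => [|k xk].
    by case: n n_gt0 xn {n_min} => [|[|n]] // _ /eqP; rewrite mulr1n (negPf x0).
  rewrite /dvdn; case: (posnP (k %% n)) => [//|r_gt0].
  have : S (k %% n)%N.
    rewrite /S r_gt0 -xk {2}(divn_eq k n) mulrnDr mulnC mulrnA xn mul0rn add0r.
    by rewrite eqxx.
  by move=> /n_min; rewrite leqNgt ltn_mod n_gt0.
pose e : QmodZ := \pi_QmodZ (n%:R^-1).
have n0 : n%:R != 0 :> rat by rewrite pnatr_eq0; case: n n_gt1 {nP e}.
have eM k : (n %| k)%N -> e *+ k = 0.
  move=> /dvdnP[q ->]; rewrite -raddfMn -[_^-1 *+ _]mulr_natr natrM mulrCA mulVf // mulr1.
  apply/eqP; rewrite QmodZ_eq0.
  by rewrite -[q%:R]mulrz_nat intr_int.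
have gG : additive_graph [set u | exists k : int, u = (x *~ k, e *~ k)].
  split=> [|_ _ [k ->] [l ->]|d [k [xk ->]]].
  - by exists 0.
  - by exists (k - l); rewrite !mulrzBr.
  - case: k xk => k /esym; first by move/nP/eM.
    by rewrite NegzE !mulrNz -!pmulrn => /eqP; rewrite oppr_eq0 => /eqP/nP/eM ->; rewrite oppr0.
have [h hP] := additive_extension QmodZ_divisible gG.
exists h; rewrite (hP x e); last by exists 1.
rewrite QmodZ_eq0.
apply/negP => /intrP[m] /(congr1 (fun t => t * n%:R)); rewrite mulVf //.
rewrite -[n%:R]mulrz_nat -intrM => /eqP; rewrite -[1]/(1%:~R) eqr_int => /eqP m1.
have : (n %| absz (m * n%:R)%R)%N by rewrite abszM natz dvdn_mull.
by rewrite -m1 dvdn1 => /eqP n1; rewrite n1 in n_gt1.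
Qed.
End RationalsModIntegers.

Section Coinduced.
Context (R : comNzRingType) (I : Type) (D : zmodType).

Definition coind_pred : {pred I -> R -> D} :=
  [pred F | `[< forall i, zmod_morphism (F i) >]].
Lemma coind_pred_closed : zmod_closed coind_pred.
Proof.
split=> [|F G /asboolP Fadd /asboolP Gadd]; apply/asboolP => i x y.
  by rewrite subrr.
rewrite -[LHS]/(F i (x - y) - G i (x - y)) Fadd Gadd.
by rewrite -[RHS]/((F i x - G i x) - (F i y - G i y)) !opprD !opprK addrACA.
Qed.
HB.instance Definition _ :=
  GRing.isZmodClosed.Build (I -> R -> D) coind_pred coind_pred_closed.

(* [Hom_Z(R, D)^I], with [R] acting on the argument *)
Definition coind : Type := {F : I -> R -> D | F \in coind_pred}.
HB.instance Definition _ := [isSub of coind for @sval _ _].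
HB.instance Definition _ := [Choice of coind by <:].
HB.instance Definition _ := [SubChoice_isSubZmodule of coind by <:].

Lemma coindB (F : coind) i x y : val F i (x - y) = val F i x - val F i y.
Proof. by have /asboolP/(_ i x y) := valP F. Qed.

Lemma coind_scale_subproof (c : R) (F : coind) :
  (fun i x => val F i (x * c)) \in coind_pred.
Proof. by apply/asboolP => i x y; rewrite mulrBl coindB. Qed.
Definition coind_scale (c : R) (F : coind) : coind :=
  Sub (fun i x => val F i (x * c)) (coind_scale_subproof c F).

Lemma coind_scaleA a b F : coind_scale a (coind_scale b F) = coind_scale (a * b) F.
Proof.
by apply: val_inj; apply/funext => i; apply/funext => x; rewrite /= mulrA.
Qed.
Lemma coind_scale1 : left_id 1 coind_scale.
Proof.
by move=> F; apply: val_inj; apply/funext => i; apply/funext => x; rewrite /= mulr1.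
Qed.
Lemma coind_scaleDr : right_distributive coind_scale +%R.
Proof.
by move=> a F G; apply: val_inj; apply/funext => i; apply/funext => x.
Qed.
Lemma coind_scaleDl F : {morph coind_scale^~ F : a b / a + b}.
Proof.
move=> a b; apply: val_inj; apply/funext => i; apply/funext => x.
have := coindB F i (x * (a + b)) (x * b).
rewrite -mulrBr addrK /= => /eqP.
by rewrite eq_sym subr_eq => /eqP.
Qed.
HB.instance Definition _ := GRing.Zmodule_isLmodule.Build R coind
  coind_scaleA coind_scale1 coind_scaleDr coind_scaleDl.

Lemma coind_injective : divisible D -> injective_module coind.
Proof.
move=> divD U V f g f_inj.
have /choice[h hP] (i : I) :
    exists h : {additive V -> D}, forall x, h (f x) = val (g x) i 1.
  pose G : set (V * D) := [set u | exists x, u = (f x, val (g x) i 1)].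
  have gG : additive_graph G.
    split=> [|_ _ [x ->] [y ->]|d [x []]].
    - by exists 0; rewrite !linear0.
    - by exists (x - y); rewrite !linearB.
    - by rewrite -(linear0 f) => /f_inj <- ->; rewrite linear0.
  have [h hP] := additive_extension divD gG.
  by exists h => x; apply: hP; exists x.
have kP v : (fun i r => h i (r *: v)) \in coind_pred.
  by apply/asboolP => i x y; rewrite scalerBl raddfB.
pose k v : coind := Sub (fun i r => h i (r *: v)) (kP v).
have k_lin : linear k.
  move=> c x y; apply: val_inj; apply/funext => i; apply/funext => r.
  by rewrite /= scalerDr raddfD scalerA.
pose kk := GRing.isLinear.Build R V coind *:%R k k_lin.
pose k' : {linear V -> coind} := HB.pack k kk.
exists k' => x; apply: val_inj; apply/funext => i; apply/funext => r.
by rewrite /= -linearZ hP linearZ /= mul1r.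
Qed.
End Coinduced.

Section EnoughInjectives.
Context (R : comNzRingType).
Implicit Type M : lmodType R.

Definition big_injective M : lmodType R := coind R {additive M -> QmodZ} QmodZ.

Lemma to_injective_subproof M (x : M) :
  (fun (chi : {additive M -> QmodZ}) (r : R) => chi (r *: x)) \in
     @coind_pred R {additive M -> QmodZ} QmodZ.
Proof. by apply/asboolP => chi r s; rewrite scalerBl raddfB. Qed.
Definition to_injective M (x : M) : big_injective M :=
  (Sub (fun (chi : {additive M -> QmodZ}) (r : R) => chi (r *: x))
    (to_injective_subproof x) : coind R {additive M -> QmodZ} QmodZ).

Lemma to_injective_is_linear M : linear (@to_injective M).
Proof.
move=> c x y; apply: val_inj; apply/funext => chi; apply/funext => r.
by rewrite /= scalerDr raddfD scalerA.
Qed.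
HB.instance Definition _ M :=
  GRing.isLinear.Build R M (big_injective M) *:%R (@to_injective M)
    (@to_injective_is_linear M).

Lemma to_injective_inj M : injective (@to_injective M).
Proof.
apply: raddf_inj => x /(congr1 val) x0; apply: contrapT => /eqP/QmodZ_separates[chi].
by have /(congr1 (fun F => F chi 1)) /= := x0; rewrite scale1r => ->; rewrite eqxx.
Qed.

Fixpoint cosyzygy M n : lmodType R :=
  if n is m.+1 then quotmod (immod (@to_injective (cosyzygy M m))) else M.

Definition inj_obj M n := big_injective (cosyzygy M n).

Definition inj_diff M n : {linear inj_obj M n -> inj_obj M n.+1} :=
  @to_injective (cosyzygy M n.+1) \o
  @quotmod_pi _ _ (immod (@to_injective (cosyzygy M n))).

Lemma inj_diff_eq0 M n x :
  inj_diff M n x = 0 <-> exists y, @to_injective (cosyzygy M n) y = x.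
Proof.
rewrite /inj_diff /= -[X in _ = X](raddf0 (@to_injective (cosyzygy M n.+1))).
split=> [/to_injective_inj|[y xy]].
  rewrite -(raddf0 (@quotmod_pi _ _ (immod (@to_injective (cosyzygy M n))))).
  by move/quotmod_piP; rewrite subr0 => /asboolP.
congr (to_injective _).
rewrite -(raddf0 (@quotmod_pi _ _ (immod (@to_injective (cosyzygy M n))))).
by apply/quotmod_piP; rewrite subr0; apply/asboolP; exists y.
Qed.

Lemma inj_diffK M n x : inj_diff M n.+1 (inj_diff M n x) = 0.
Proof.
apply: (iffRL (inj_diff_eq0 (n := n.+1) (inj_diff M n x))).
by exists (quotmod_pi (immod (@to_injective (cosyzygy M n))) x).
Qed.

Lemma inj_diff_exact M n x : inj_diff M n.+1 x = 0 -> exists y, inj_diff M n y = x.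
Proof.
move=> /(iffLR (inj_diff_eq0 (n := n.+1) x))[y <-].
by elim/(@quotmod_ind _ _ (immod (@to_injective (cosyzygy M n)))): y => y; exists y.
Qed.

Definition standard_injective_resolution M : injective_resolution M :=
  @InjectiveResolution R M (CochainComplex (@inj_diffK M)) (@to_injective M)
    (fun n => coind_injective QmodZ_divisible) (@to_injective_inj M)
    (@inj_diff_eq0 M 0) (@inj_diff_exact M).
End EnoughInjectives.

Section LocalCohomology.
Context (R : comNzRingType) (a : ideal R).
Implicit Types V : lmodType R.

(* [torsion a] derived on the right; other injective resolutions give
   isomorphic modules *)
Definition local_cohomology (i : nat) V : lmodType R :=
  cohomology (torsion_complex a (standard_injective_resolution V)) i.

Definition cohomological_dimension V : \bar nat :=
  nat_sup [set i | nonzero_module (local_cohomology i V)].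

End LocalCohomology.

(* Main.v *)
Require Import Defs.
From HB Require Import structures.
From mathcomp Require Import all_boot all_order all_algebra.
From mathcomp Require Import boolp classical_sets functions constructive_ereal.
From mathcomp Require Import cardinality.
Set Implicit Arguments.
Unset Strict Implicit.
Unset Printing Implicit Defensive.
Import GRing.Theory.
Local Open Scope classical_set_scope.
Local Open Scope ring_scope.

(** Fix M of dimension d, let T be the d-th local cohomology functor with support
in a, I the annihilator of M, and p_1, ..., p_n the primes p over I with
dim R/p = d.  They are minimal over I, hence finite in number and associated to
M: they are the elements of Assh M.

The engine is right exactness.  Local cohomology vanishes above the dimension
of the support ([derived_torsion_vanish]), so among finitely generated modules
killed by I a map whose cokernel has dimension less than d becomes surjective
under T ([derived_torsion_right_exact]).  Applied to multiplication by c on M,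
this makes c surjective on T(M) as soon as c avoids every p_i.

This yields a secondary representation of T(M).  Choose s_i outside p_i such
that each c in p_i has a power with s_i c^k in I, and such that s_i s_j is in I
for i <> j ([separators]).  The sum of the s_i avoids every p_i, so T(M) is the sum of the
submodules s_i T(M).  An element c of p_i is nilpotent on s_i T(M).  If c is
not in p_i, then c s_i + (sum of the other s_j) avoids every p_j, hence is
surjective on T(M), and multiplying by s_i gives s_i T(M) = c s_i^2 T(M): so c
is surjective on s_i T(M), which is therefore zero or p_i-secondary
([separated_secondary]).

It remains to see which p_i survive.  There is a map from M to R/p_i whose
cokernel has smaller dimension, so T(R/p_i), which is zero or p_i-secondary, is
a quotient of T(M).  Conversely, if T(R/p_i) = 0, then a prime filtration of
s_i M shows T(s_i M) = 0, and multiplication by s_i on T(M) factors through this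
module.  Both inclusions of the theorem then follow from one fact
([secondary_quotient]): if a nonzero quotient of a sum of secondary modules has
a prime p as its set of nilpotent multipliers, then p is attached to one of the
summands whose image is nonzero.  Finally T(R/p) is nonzero exactly when the
cohomological dimension of R/p is d, again by the vanishing theorem.

Functoriality and long exact sequences come from satellites: the right
satellite of a half-exact functor is half exact, and the i-th satellite of the
torsion functor is isomorphic to the i-th local cohomology computed from the
standard injective resolution ([local_cohomology_iso]).  The vanishing theorem
is proved by induction on i, along a prime filtration.  For R/p either an
element of a acts injectively, and multiplication by it lowers the dimension,
or R/p is torsion; the latter case rests on the injectivity of the torsion
submodule of an injective module ([torsion_injective]). *)

(** * Linear maps, submodules and short exact sequences *)

(* Simplification would otherwise replace membership in these submodules by
   the underlying boolean predicates. *)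
Arguments spanmod : simpl never.
Arguments immod : simpl never.
Arguments kermod : simpl never.
Arguments quotmod_pi : simpl never.
Arguments to_injective : simpl never.
Arguments elt_annihilator : simpl never.
Arguments annihilator : simpl never.
Arguments radical : simpl never.
Arguments torsion : simpl never.
Arguments ideal_mul : simpl never.
Arguments ideal_exp : simpl never.
Arguments sum_submod : simpl never.

Section LinearMaps.
Context (R : comNzRingType).
Implicit Types (U V W A B C X : lmodType R).

Definition mklin U V (f : U -> V) (fP : linear f) : {linear U -> V} :=
  HB.pack f (GRing.isLinear.Build R U V *:%R f fP).

Lemma submod_eq V (W W' : submod V) : W =i W' -> W = W'.
Proof.
case: W => p pP; case: W' => q qP /= pq.
have e : p = q by apply/funext => x; exact: pq.
by move: pP qP; rewrite e => pP qP; congr Submod; exact: Prop_irrelevance.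
Qed.

Lemma linear_inj A B (f : {linear A -> B}) : (forall x, f x = 0 -> x = 0) -> injective f.
Proof. exact: raddf_inj. Qed.

Definition short_exact A B C (f : {linear A -> B}) (g : {linear B -> C}) :=
  [/\ injective f, forall c, exists b, g b = c &
      forall b, g b = 0 <-> exists a, f a = b].

Lemma linear_descend B C X (g : {linear B -> C}) (h : {linear B -> X}) :
  (forall c, exists b, g b = c) -> (forall b, g b = 0 -> h b = 0) ->
  exists h' : {linear C -> X}, forall b, h' (g b) = h b.
Proof.
move=> /choice[s sK] gh.
have hE b b' : g b = g b' -> h b = h b'.
  move=> e; apply/eqP; rewrite -subr_eq0 -linearB; apply/eqP/gh.
  by rewrite linearB e subrr.
have lin : linear (h \o s).
  by move=> c x y; rewrite /= -linearP; apply: hE; rewrite linearP !sK.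
by exists (mklin lin) => b; apply: hE; rewrite sK.
Qed.

Lemma linear_corestrict A B X (f : {linear A -> B}) (h : {linear X -> B}) :
  injective f -> (forall x, exists a, f a = h x) ->
  exists h' : {linear X -> A}, forall x, f (h' x) = h x.
Proof.
move=> finj /choice[s sK].
have lin : linear s by move=> c x y; apply: finj; rewrite linearP !sK linearP.
by exists (mklin lin) => x; apply: sK.
Qed.

Lemma short_exact0 A B C (f : {linear A -> B}) (g : {linear B -> C}) a :
  short_exact f g -> g (f a) = 0.
Proof. by case=> _ _ /(_ (f a))[_ ->] //; exists a. Qed.

Lemma short_exact0P A B C (f : {linear A -> B}) (g : {linear B -> C}) b :
  short_exact f g -> g b = 0 -> exists a, f a = b.
Proof. by case=> _ _ /(_ b)[]. Qed.

Definition submod_val V (W : submod V) : {linear submod_of W -> V} :=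
  \val.

Lemma submod_val_inj V (W : submod V) : injective (submod_val W).
Proof. exact: val_inj. Qed.

Lemma quotmod_eq0 V (W : submod V) x : quotmod_pi W x = 0 <-> x \in W.
Proof. by rewrite -(raddf0 (quotmod_pi W)) quotmod_piP subr0. Qed.

Lemma quotmod_surj V (W : submod V) (y : quotmod W) : exists x, quotmod_pi W x = y.
Proof. by elim/quotmod_ind: y => x; exists x. Qed.

Lemma short_exact_submod V (W : submod V) :
  short_exact (submod_val W) (quotmod_pi W).
Proof.
split; [by move=> ? ? /val_inj | exact: quotmod_surj |] => x.
rewrite quotmod_eq0; split=> [xW|[y <-]]; last exact: valP.
by exists (Sub x xW).
Qed.

Lemma in_kermod U V (f : {linear U -> V}) x : (x \in kermod f) = (f x == 0).
Proof. by []. Qed.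

Lemma in_immod U V (f : {linear U -> V}) y : y \in immod f <-> exists x, f x = y.
Proof. by split => [/asboolP|?]; last apply/asboolP. Qed.

Lemma short_exact_ker B C (g : {linear B -> C}) :
  (forall c, exists b, g b = c) -> short_exact (submod_val (kermod g)) g.
Proof.
move=> gs; split; [by move=> ? ? /val_inj | by [] |].
move=> b; split=> [gb|[y <-]]; last by apply/eqP; exact: (valP y).
have bk : b \in kermod g by rewrite in_kermod gb.
by exists (Sub b bk).
Qed.

Lemma short_exact_im A B (f : {linear A -> B}) :
  injective f -> short_exact f (quotmod_pi (immod f)).
Proof.
move=> finj; split=> //; first exact: quotmod_surj.
by move=> b; rewrite quotmod_eq0 in_immod.
Qed.

Lemma image_factorization A B (f : {linear A -> B}) :
  exists2 g : {linear A -> submod_of (immod f)},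
    forall y, exists x, g x = y & forall x, submod_val (immod f) (g x) = f x.
Proof.
have [|g gE] := @linear_corestrict _ _ _ (submod_val (immod f)) f (@submod_val_inj _ _).
  move=> x; have xf : f x \in immod f by apply/in_immod; exists x.
  by exists (Sub (f x) xf).
exists g => // y; have /in_immod[x xy] := valP y; exists x.
by apply: submod_val_inj; rewrite gE.
Qed.

Lemma mulr_gen_linear V (v : V) : linear (fun c : R^o => (c : R) *: v).
Proof. by move=> c x y; rewrite scalerDl -scalerA. Qed.
Definition mulr_gen V (v : V) : {linear R^o -> V} := mklin (mulr_gen_linear v).

Lemma scale_map_linear V (c : R) : linear (fun x : V => c *: x).
Proof. by move=> b x y; rewrite scalerDr !scalerA mulrC. Qed.
Definition scale_map V (c : R) : {linear V -> V} := mklin (scale_map_linear c).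

Lemma lincomb_linear U V (c : R) (f g : {linear U -> V}) :
  linear (fun x => c *: f x + g x).
Proof.
move=> b x y; rewrite (linearP f) (linearP g) !scalerDr !scalerA [c * b]mulrC.
by rewrite addrACA.
Qed.
Definition lincomb U V (c : R) (f g : {linear U -> V}) : {linear U -> V} :=
  mklin (lincomb_linear c f g).

Lemma pair_fst_linear A B : linear (fst : A * B -> A).
Proof. by []. Qed.
Lemma pair_snd_linear A B : linear (snd : A * B -> B).
Proof. by []. Qed.
Lemma pair_inl_linear A B : linear (fun x : A => (x, 0) : A * B).
Proof. by move=> c x y; congr pair; rewrite /= scaler0 addr0. Qed.
Lemma pair_inr_linear A B : linear (fun x : B => (0, x) : A * B).
Proof. by move=> c x y; congr pair; rewrite /= scaler0 addr0. Qed.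

Lemma spanmod_nil V x : (x \in spanmod [set` ([::] : seq V)]) = (x == 0).
Proof.
apply/idP/eqP => [/asboolP/(_ (zeromod V))|->]; last exact: rpred0.
by rewrite inE => /(_ _)/eqP; apply=> y.
Qed.

Lemma spanmod_sub V (s : seq V) (W : submod V) :
  {subset s <= W} -> {subset spanmod [set` s] <= W}.
Proof. by move=> sW x /asboolP; apply. Qed.

Lemma mem_spanmod V (s : seq V) : {subset s <= spanmod [set` s]}.
Proof. by move=> x xs; apply/asboolP => W; apply. Qed.

Lemma adjoin_closed V (y : V) (W : submod V) :
  submod_closed [pred x : V | `[< exists c z, z \in W /\ x = c *: y + z >]].
Proof.
split=> [|c u v /asboolP[b [z [zW ->]]] /asboolP[b' [z' [zW' ->]]]].
  by apply/asboolP; exists 0, 0; split; rewrite ?scale0r ?addr0 //; exact: rpred0.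
apply/asboolP; exists (c * b + b'), (c *: z + z').
by rewrite rpredD ?rpredZ // scalerDr scalerDl scalerA addrACA.
Qed.

Definition adjoin V (W : submod V) (y : V) : submod V := Submod (adjoin_closed y W).

Lemma in_adjoin V (W : submod V) (y x : V) :
  x \in adjoin W y <-> exists c z, z \in W /\ x = c *: y + z.
Proof. by split=> [/asboolP|?]; last apply/asboolP. Qed.

Lemma subset_adjoin V (W : submod V) (y : V) : {subset W <= adjoin W y}.
Proof. by move=> x xW; apply/in_adjoin; exists 0, x; rewrite scale0r add0r. Qed.

Lemma mem_adjoin V (W : submod V) (y : V) : y \in adjoin W y.
Proof. by apply/in_adjoin; exists 1, 0; rewrite scale1r addr0 rpred0. Qed.

Lemma spanmod_cons V (y : V) s x : x \in spanmod [set` y :: s] <->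
  exists c z, z \in spanmod [set` s] /\ x = c *: y + z.
Proof.
split=> [|[c [z [zs ->]]]].
  suff sub : {subset spanmod [set` y :: s] <= adjoin (spanmod [set` s]) y}.
    by move/sub/in_adjoin.
  apply: spanmod_sub => z; rewrite in_cons => /orP[/eqP->|zs].
    exact: mem_adjoin.
  exact/subset_adjoin/mem_spanmod.
rewrite rpredD ?rpredZ //; first by apply: mem_spanmod; rewrite mem_head.
by apply: spanmod_sub zs => u us; apply: mem_spanmod; rewrite in_cons us orbT.
Qed.

Lemma spanmod_map U V (f : {linear U -> V}) (s : seq U) y :
  y \in spanmod [set` map f s] <-> exists2 x, x \in spanmod [set` s] & f x = y.
Proof.
split=> [|[x xs <-]].
  elim: s y => [|u s IH] y.
    rewrite /= spanmod_nil => /eqP->; exists 0; last exact: linear0.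
    by rewrite spanmod_nil.
  rewrite /= => /spanmod_cons[c [z [/IH[x xs <-] ->]]].
  by exists (c *: u + x); rewrite ?linearP //; apply/spanmod_cons; exists c, x.
elim: s x xs => [|u s IH] x; first by rewrite spanmod_nil => /eqP->; rewrite linear0 rpred0.
by move=> /spanmod_cons[c [z [/IH zs ->]]]; rewrite linearP; apply/spanmod_cons; exists c, (f z).
Qed.

Lemma capmod_closed V (W W' : submod V) :
  submod_closed [pred x : V | (x \in W) && (x \in W')].
Proof.
split=> [|c x y /andP[xW xW'] /andP[yW yW']]; rewrite inE ?rpred0 //.
by rewrite !rpredD ?rpredZ.
Qed.
Definition capmod V (W W' : submod V) : submod V := Submod (capmod_closed W W').

Lemma fg_submodP V (W : submod V) : finitely_generated (submod_of W) <->
  exists2 s : seq V, {subset s <= W} & {subset W <= spanmod [set` s]}.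
Proof.
split=> [[s sW]|[s sW Ws]].
  exists (map (submod_val W) s) => [_ /mapP[x _ ->]|x xW]; first exact: valP.
  by apply/spanmod_map; exists (Sub x xW).
exists (pmap insub s) => x.
have E : s = map (submod_val W) (pmap insub s).
  rewrite (pmap_filter (insubK _)); apply/esym/all_filterP/allP => y /sW yW.
  by rewrite insubT.
by have := Ws _ (valP x); rewrite {1}E => /spanmod_map[y ys /val_inj <-].
Qed.

Lemma fg_image U V (f : {linear U -> V}) : (forall y, exists x, f x = y) ->
  finitely_generated U -> finitely_generated V.
Proof.
move=> fs [s sP]; exists (map f s) => y; have [x <-] := fs y.
by apply/spanmod_map; exists x.
Qed.

Lemma fg_exhaust V (W : nat -> submod V) : finitely_generated V ->
  (forall m n, (m <= n)%N -> {subset W m <= W n}) ->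
  (forall x, exists n, x \in W n) -> exists n, forall x, x \in W n.
Proof.
move=> [s sP] Wmono Wcov.
suff [n sn] : exists n, {subset s <= W n}.
  by exists n => x; apply: spanmod_sub (sP x).
elim: s {sP} => [|y s [n sn]]; first by exists 0%N.
have [m ym] := Wcov y; exists (m + n)%N => z; rewrite in_cons => /orP[/eqP->|/sn].
  by apply: Wmono ym; apply: leq_addr.
by apply: Wmono; apply: leq_addl.
Qed.

End LinearMaps.

(** * Noetherian rings *)

Section Noetherian.
Context (R : comNzRingType) (RN : noetherian R).
Implicit Types (I J K p q : ideal R) (V : lmodType R).

Lemma ideal_maximal (P : ideal R -> Prop) : (exists I, P I) ->
  exists I, P I /\ forall J, P J -> {subset I <= J} -> {subset J <= I}.
Proof.
move=> [I0 PI0]; apply: contrapT => noMax.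
have step (u : {I | P I}) : exists v : {I | P I},
    {subset projT1 u <= projT1 v} /\ ~ {subset projT1 v <= projT1 u}.
  case: u => I PI /=; apply: contrapT => nov; apply: noMax; exists I; split=> // J PJ IJ.
  by apply: contrapT => JI; apply: nov; exists (exist _ J PJ).
have [f fP] := choice step.
pose c n := projT1 (iter n f (exist _ I0 PI0)).
have cS n : {subset c n <= c n.+1} /\ ~ {subset c n.+1 <= c n} by exact: fP.
have cmono m n : (m <= n)%N -> {subset c m <= c n}.
  move=> /subnK <-; elim: (n - m)%N => // k IH x /IH; exact: (cS _).1.
have Ucl : submod_closed [pred x : R^o | `[< exists n, x \in c n >]].
  split=> [|b x y /asboolP[m xm] /asboolP[n yn]].
    by apply/asboolP; exists 0%N; apply: rpred0.
  apply/asboolP; exists (m + n)%N; rewrite rpredD ?rpredZ //.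
    by apply: cmono xm; apply: leq_addr.
  by apply: cmono yn; apply: leq_addl.
pose U : ideal R := Submod Ucl.
have [n cn] : exists n, forall x : submod_of U, x \in restrmod U (c n).
  apply: fg_exhaust (RN U) _ _ => [m n mn x|x]; last by apply/asboolP; exact: (valP x).
  exact: cmono.
apply: (cS n).2 => x xn.
have xU : x \in U by apply/asboolP; exists n.+1.
exact: (cn (Sub x xU)).
Qed.

(** Noetherian induction; the element x witnesses that the inclusion of I in J
is strict. *)
Lemma ideal_ind (P : ideal R -> Prop) :
  (forall I, (forall J x, {subset I <= J} -> x \in J -> x \notin I -> P J) -> P I) ->
  forall I, P I.
Proof.
move=> IH I0; apply: contrapT => nP0.
have [I [nPI Imax]] := @ideal_maximal (fun I => ~ P I) (ex_intro _ I0 nP0).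
apply: nPI; apply: IH => J x IJ xJ xI; apply: contrapT => nPJ.
by move: xI; rewrite (Imax J nPJ IJ x xJ).
Qed.

(** Induction on the generators: for the first generator y, the coefficients of
y in elements of W form an ideal; lifts of its generators to W, together with
generators of the part of W spanned by the remaining generators, span W. *)
Lemma fg_subset V (s : seq V) (W : submod V) : {subset W <= spanmod [set` s]} ->
  finitely_generated (submod_of W).
Proof.
move=> Ws; apply/fg_submodP.
elim: s W Ws => [|y s IH] W Ws; first by exists [::].
have Icl : submod_closed
    [pred c : R^o | `[< exists w, w \in W /\ w - (c : R) *: y \in spanmod [set` s] >]].
  split=> [|b c d /asboolP[w [wW ws]] /asboolP[w' [wW' ws']]]; apply/asboolP.
    by exists 0; rewrite scale0r subr0 !rpred0.
  exists (b *: w + w'); rewrite rpredD ?rpredZ //; split=> //.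
  by rewrite scalerDl -scalerA opprD addrACA -scalerBr rpredD ?rpredZ.
pose I : ideal R := Submod Icl.
have [rs rsP] := RN I.
have /choice[g gP] (c : submod_of I) : exists w, w \in W /\
    w - (val c : R) *: y \in spanmod [set` s] by apply/asboolP; exact: (valP c).
have [t' t'W Wt'] := IH (capmod W (spanmod [set` s])) (fun x xW => (andP xW).2).
exists (map g rs ++ t').
  move=> x; rewrite mem_cat => /orP[/mapP[c _ ->]|/t'W/andP[]//]; exact: (gP c).1.
move=> x xW; have /spanmod_cons[c [z [zs xE]]] := Ws x xW.
have cI : c \in I.
  by apply/asboolP; exists x; split=> //; rewrite xE addrAC subrr add0r.
have span_rs (b : submod_of I) : b \in spanmod [set` rs] ->
    exists u, [/\ u \in W, u \in spanmod [set` map g rs] &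
               u - (val b : R) *: y \in spanmod [set` s]].
  elim: rs b {rsP} => [|r rs IHr] b.
    by rewrite spanmod_nil => /eqP->; exists 0; rewrite !rpred0 scale0r subr0 rpred0.
  move=> /spanmod_cons[e [v [/IHr[u [uW us uy]] ->]]].
  exists (e *: g r + u); split; first by rewrite rpredD ?rpredZ ?(gP r).1.
    by apply/spanmod_cons; exists e, u.
  have -> : val (e *: r + v) = e * (val r : R) + (val v : R) by [].
  rewrite scalerDl -scalerA opprD addrACA -scalerBr.
  by rewrite rpredD ?rpredZ // (gP r).2.
have [u [uW ug uy]] := span_rs (Sub c cI) (rsP _).
have xut : x - u \in spanmod [set` t'].
  apply: Wt'; apply/andP; split; first exact: rpredB.
  have -> : x - u = z - (u - (c : R) *: y) by rewrite xE opprB addrCA addrA.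
  by rewrite rpredB.
rewrite -(subrK u x) rpredD //.
  by apply: spanmod_sub xut => v vt; apply: mem_spanmod; rewrite mem_cat vt orbT.
by apply: spanmod_sub ug => v vt; apply: mem_spanmod; rewrite mem_cat vt.
Qed.

Lemma fg_submod V (W : submod V) : finitely_generated V -> finitely_generated (submod_of W).
Proof. by move=> [s sP]; apply: (@fg_subset V s). Qed.

End Noetherian.

Section Ideals.
Context (R : comNzRingType).
Implicit Types (I J K a p : ideal R) (V : lmodType R).

Lemma in_annihilator V (c : R) : c \in annihilator V <-> forall x : V, c *: x = 0.
Proof. by split=> [/asboolP//|?]; apply/asboolP. Qed.

Lemma in_elt_annihilator V (v : V) (r : R) : r \in elt_annihilator v <-> r *: v = 0.
Proof. by split=> /eqP. Qed.

Lemma idealD I (x y : R) : x \in I -> y \in I -> x + y \in I.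
Proof. exact: (@rpredD R^o I). Qed.

Lemma idealB I (x y : R) : x \in I -> y \in I -> x - y \in I.
Proof. exact: (@rpredB R^o I). Qed.

Lemma ideal0 I : (0 : R) \in I.
Proof. exact: (rpred0 I). Qed.

Lemma colon_closed I (x : R) : submod_closed [pred r : R^o | (r : R) * x \in I].
Proof.
split=> [|c u v]; rewrite !inE ?mul0r ?(rpred0 I) // => uI vI.
have -> : (c *: u + v : R^o) * x = c * ((u : R) * x) + (v : R) * x :> R.
  by rewrite mulrA -mulrDl.
by apply: idealD => //; exact: ideal_mulr_closed.
Qed.
Definition colon I x : ideal R := Submod (colon_closed I x).

Lemma in_colon I (x r : R) : (r \in colon I x) = (r * x \in I).
Proof. by []. Qed.

Lemma subset_colon I (x : R) : {subset I <= colon I x}.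
Proof. by move=> r rI; rewrite in_colon mulrC; exact: ideal_mulr_closed. Qed.

Lemma ideal_mul_sub I J K : (forall x y : R, x \in I -> y \in J -> x * y \in K) ->
  {subset ideal_mul I J <= K}.
Proof. by move=> H z /asboolP; apply => _ [x [y [xI yJ ->]]]; apply: H. Qed.

Lemma mem_ideal_mul I J (x y : R) : x \in I -> y \in J -> x * y \in ideal_mul I J.
Proof. by move=> xI yJ; apply/asboolP => W; apply; exists x, y. Qed.

Lemma ideal_expX a n (x : R) : x \in a -> x ^+ n \in ideal_exp a n.
Proof. by move=> xa; elim: n => // n IH; rewrite exprS; exact: mem_ideal_mul. Qed.

Lemma ideal_exp_add a m n J :
  (forall u v : R, u \in ideal_exp a m -> v \in ideal_exp a n -> u * v \in J) ->
  {subset ideal_exp a (m + n) <= J}.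
Proof.
elim: m J => [|m IH] J H; first by move=> v va; rewrite -[v]mul1r; apply: H.
apply: ideal_mul_sub => x y xa yamn; rewrite mulrC -in_colon.
apply: IH yamn => u v um vn; rewrite in_colon mulrC mulrA.
by apply: H => //; apply: mem_ideal_mul.
Qed.

(** Noetherian induction on K.  If x in a is not in K, let w be the last power
of x outside K: both K + (w) and (K : w) are larger than K, and the product of
the two powers of a that they contain lies in K. *)
Lemma ideal_exp_sub a K : noetherian R -> (forall x : R, x \in a -> exists k, x ^+ k \in K) ->
  exists m, {subset ideal_exp a m <= K}.
Proof.
move=> RN; elim/(ideal_ind RN): K => K IH aK.
have [sub|/existsNP[x /not_implyP[xa xK]]] := pselect (forall x, x \in a -> x \in K).
  by exists 1%N; apply: ideal_mul_sub => x y /sub xK _; rewrite mulrC ideal_mulr_closed.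
have [k xk k_min] := ex_minnP (aK x xa).
case: k xk k_min => [|k] xk k_min.
  by case: xK; rewrite -[x]mulr1; exact: ideal_mulr_closed.
have kK : x ^+ k \notin K by apply/negP => /k_min; rewrite ltnn.
have [|m mP] := IH (adjoin K (x ^+ k)) (x ^+ k) (@subset_adjoin _ _ _ _) (mem_adjoin _ _) kK.
  by move=> y /aK[l yl]; exists l; apply: subset_adjoin.
have [||n nP] := IH (colon K (x ^+ k)) x (@subset_colon _ _) _ (introN idP xK).
- by rewrite in_colon -exprS.
- by move=> y /aK[l yl]; exists l; apply: subset_colon.
exists (m + n)%N; apply: ideal_exp_add => u v /mP/in_adjoin[c [z [zK ->]]] /nP.
rewrite in_colon => vK.
rewrite mulrDl; apply: idealD; last by rewrite mulrC; exact: ideal_mulr_closed.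
by rewrite -mulrA [_ * v]mulrC; exact: ideal_mulr_closed.
Qed.

End Ideals.

(** * Half-exact functors and their right satellites *)

(** The laws are stated pointwise on maps that are only extensionally equal to
an identity, a composite or a linear combination, so that any convenient
representative of such a map may be used. *)
Record half_exact_functor (R : comNzRingType) := HalfExactFunctor {
  fobj :> lmodType R -> lmodType R;
  fmap : forall A B : lmodType R, {linear A -> B} -> {linear fobj A -> fobj B};
  fmap_id : forall (A : lmodType R) (f : {linear A -> A}),
    (forall x, f x = x) -> forall y, fmap f y = y;
  fmap_comp : forall (A B C : lmodType R) (f : {linear A -> B})
      (g : {linear B -> C}) (h : {linear A -> C}),
    (forall x, h x = g (f x)) -> forall y, fmap h y = fmap g (fmap f y);
  fmap_lin : forall (A B : lmodType R) (c : R) (f g h : {linear A -> B}),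
    (forall x, h x = c *: f x + g x) -> forall y, fmap h y = c *: fmap f y + fmap g y;
  fmap_exact : forall (A B C : lmodType R) (f : {linear A -> B}) (g : {linear B -> C}),
    short_exact f g -> forall y, fmap g y = 0 -> exists x, fmap f x = y }.

Section FunctorTheory.
Context (R : comNzRingType) (F : half_exact_functor R).
Implicit Types (A B C D J X Y : lmodType R).

Lemma fmap_ext A B (f g : {linear A -> B}) : f =1 g -> fmap F f =1 fmap F g.
Proof. by move=> fg y; rewrite (fmap_comp (f := idfun) (g := g)) ?fmap_id. Qed.

Lemma fmap_compE A B C (f : {linear A -> B}) (g : {linear B -> C}) y :
  fmap F g (fmap F f y) = fmap F (g \o f) y.
Proof. by rewrite (fmap_comp (f := f) (g := g)). Qed.

Lemma fmap0 A B (f : {linear A -> B}) y : (forall x, f x = 0) -> fmap F f y = 0.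
Proof.
move=> f0; apply: (addrI (fmap F f y)); rewrite addr0.
rewrite -{1}[fmap F f y]scale1r -(fmap_lin (h := f)) // => x.
by rewrite f0 addr0 scaler0.
Qed.

Lemma fmap_scale A (c : R) (f : {linear A -> A}) y :
  (forall x, f x = c *: x) -> fmap F f y = c *: y.
Proof.
move=> fc; rewrite (fmap_lin (f := idfun) (g := scale_map A 0) (c := c)).
  by rewrite fmap_id // fmap0 ?addr0 // => x; apply: scale0r.
by move=> x; rewrite fc /= scale0r addr0.
Qed.

Lemma fmapZ A B (c : R) (f h : {linear A -> B}) y :
  (forall x, h x = c *: f x) -> fmap F h y = c *: fmap F f y.
Proof.
by move=> hE; rewrite (fmap_comp (f := f) (g := scale_map B c)) // (fmap_scale (c := c)).
Qed.

Lemma fmapB A B (f g h : {linear A -> B}) y :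
  (forall x, h x = f x - g x) -> fmap F h y = fmap F f y - fmap F g y.
Proof.
move=> hE; rewrite (fmap_lin (f := g) (g := f) (c := -1)).
  by rewrite scaleN1r addrC.
by move=> x; rewrite hE scaleN1r addrC.
Qed.

Lemma fmap_zero_module A y : (forall x : A, x = 0) -> y = 0 :> F A.
Proof.
by move=> A0; rewrite -[y](fmap_id (f := idfun)) // fmap0 // => x; rewrite [LHS]A0.
Qed.

End FunctorTheory.

Section InjectiveEmbedding.
Context (R : comNzRingType).
Implicit Types (A B C J X Y Z : lmodType R).

Definition cosyz A : lmodType R := quotmod (immod (@to_injective R A)).
Definition cosyz_pi A : {linear big_injective A -> cosyz A} := quotmod_pi _.

Lemma big_injective_injective A : injective_module (big_injective A).
Proof. exact: coind_injective QmodZ_divisible. Qed.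

Lemma cosyz_short_exact A : short_exact (@to_injective R A) (cosyz_pi A).
Proof. exact/short_exact_im/to_injective_inj. Qed.

Lemma cosyz_pi0 A (x : A) : cosyz_pi A (to_injective x) = 0.
Proof. exact: short_exact0 (cosyz_short_exact A). Qed.

Lemma cosyz_surj A (y : cosyz A) : exists x, cosyz_pi A x = y.
Proof. exact: quotmod_surj. Qed.

(** A map between the left ends extends to the middle terms because X is
injective, and then descends to the right ends. *)
Lemma short_exact_lift A J Y B X Z (j : {linear A -> J}) (q : {linear J -> Y})
    (i : {linear B -> X}) (p : {linear X -> Z}) (f : {linear A -> B}) :
  short_exact j q -> injective_module X -> (forall b, p (i b) = 0) ->
  exists (u : {linear J -> X}) (v : {linear Y -> Z}),
    (forall a, u (j a) = i (f a)) /\ forall x, v (q x) = p (u x).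
Proof.
move=> [jinj qsurj jq] Xinj pi0.
have [u uP] := Xinj _ _ j (i \o f : {linear A -> X}) jinj.
have [|v vP] := @linear_descend _ _ _ _ q (p \o u : {linear J -> Z}) qsurj.
  by move=> x /jq[a <-] /=; rewrite uP /= pi0.
by exists u, v.
Qed.

(** The difference of the two lifts u and u' vanishes on A, hence descends to a
map w from Y to X.  A functor which has been divided by the image of X no
longer sees this difference: satellites do not depend on lifts. *)
Lemma short_exact_lift_unique A J Y X Z (j : {linear A -> J}) (q : {linear J -> Y})
    (p : {linear X -> Z}) (u u' : {linear J -> X}) (v v' : {linear Y -> Z}) :
  short_exact j q -> (forall a, u (j a) = u' (j a)) ->
  (forall x, v (q x) = p (u x)) -> (forall x, v' (q x) = p (u' x)) ->
  exists w : {linear Y -> X}, forall y, v y - v' y = p (w y).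
Proof.
move=> [jinj qsurj jq] uu' vE v'E.
have [|w wP] := @linear_descend _ _ _ _ q (lincomb (-1) u' u) qsurj.
  by move=> x /jq[a <-] /=; rewrite uu' scaleN1r addNr.
by exists w => y; have [x <-] := qsurj y; rewrite wP vE v'E /= linearP /= scaleN1r addrC.
Qed.

Lemma cosyz_map_exists A B (f : {linear A -> B}) :
  exists v : {linear cosyz A -> cosyz B},
    exists u : {linear big_injective A -> big_injective B},
      (forall a, u (to_injective a) = to_injective (f a)) /\
      forall x, v (cosyz_pi A x) = cosyz_pi B (u x).
Proof.
have [u [v uv]] := short_exact_lift f (cosyz_short_exact A)
  (@big_injective_injective B) (@cosyz_pi0 B).
by exists v, u.
Qed.

Definition cosyz_map A B (f : {linear A -> B}) : {linear cosyz A -> cosyz B} :=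
  projT1 (cid (cosyz_map_exists f)).

Lemma cosyz_mapP A B (f : {linear A -> B}) :
  exists u : {linear big_injective A -> big_injective B},
      (forall a, u (to_injective a) = to_injective (f a)) /\
      forall x, cosyz_map f (cosyz_pi A x) = cosyz_pi B (u x).
Proof. exact: projT2 (cid (cosyz_map_exists f)). Qed.

End InjectiveEmbedding.

Section Satellite.
Context (R : comNzRingType) (F : half_exact_functor R).
Implicit Types (A B C D J X Y : lmodType R).

(** With the injective embedding of A in E and the quotient E/A, the right
satellite of F at A is the cokernel of F(E) -> F(E/A). *)
Definition sat_bound A : submod (F (cosyz A)) := immod (fmap F (cosyz_pi A)).
Definition sat A : lmodType R := quotmod (sat_bound A).
Definition sat_pi A : {linear F (cosyz A) -> sat A} := quotmod_pi (sat_bound A).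

Lemma sat_surj A (z : sat A) : exists y, sat_pi A y = z.
Proof. exact: quotmod_surj. Qed.

Lemma sat_pi_eq0 A y : sat_pi A y = 0 <-> exists x, fmap F (cosyz_pi A) x = y.
Proof. by rewrite /sat_pi quotmod_eq0 in_immod. Qed.

Lemma sat_map_exists A B (v : {linear cosyz A -> cosyz B})
    (u : {linear big_injective A -> big_injective B}) :
  (forall x, v (cosyz_pi A x) = cosyz_pi B (u x)) ->
  exists w : {linear sat A -> sat B}, forall y, w (sat_pi A y) = sat_pi B (fmap F v y).
Proof.
move=> vu.
have [|w wP] := @linear_descend _ _ _ _ (sat_pi A)
  (sat_pi B \o fmap F v : {linear _ -> sat B}) (@sat_surj A).
  move=> y /sat_pi_eq0[x <-] /=; apply/sat_pi_eq0; exists (fmap F u x).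
  by rewrite !fmap_compE; apply: fmap_ext => x0; rewrite /= vu.
by exists w.
Qed.

Lemma sat_map_exists' A B (f : {linear A -> B}) :
  exists w : {linear sat A -> sat B},
  forall y, w (sat_pi A y) = sat_pi B (fmap F (cosyz_map f) y).
Proof. by have [u [_ /sat_map_exists]] := cosyz_mapP f. Qed.

Definition sat_map A B (f : {linear A -> B}) : {linear sat A -> sat B} :=
  projT1 (cid (sat_map_exists' f)).

Lemma sat_lift_unique A J Y B (j : {linear A -> J}) (q : {linear J -> Y})
    (u u' : {linear J -> big_injective B}) (v v' : {linear Y -> cosyz B}) :
  short_exact j q -> (forall a, u (j a) = u' (j a)) ->
  (forall x, v (q x) = cosyz_pi B (u x)) -> (forall x, v' (q x) = cosyz_pi B (u' x)) ->
  forall y, sat_pi B (fmap F v y) = sat_pi B (fmap F v' y).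
Proof.
move=> jq uu' vE v'E y.
have [w wP] := short_exact_lift_unique jq uu' vE v'E.
apply/eqP; rewrite -subr_eq0 -linearB; apply/eqP/sat_pi_eq0; exists (fmap F w y).
by rewrite -(fmap_comp (h := cosyz_pi B \o w)) //; apply: fmapB => x; rewrite wP.
Qed.

Lemma sat_mapE A B (f : {linear A -> B}) (v : {linear cosyz A -> cosyz B})
    (u : {linear big_injective A -> big_injective B}) :
  (forall a, u (to_injective a) = to_injective (f a)) ->
  (forall x, v (cosyz_pi A x) = cosyz_pi B (u x)) ->
  forall y, sat_map f (sat_pi A y) = sat_pi B (fmap F v y).
Proof.
move=> uf vu y; rewrite (projT2 (cid (sat_map_exists' f))).
have [u' [u'f vu']] := cosyz_mapP f.
by apply: sat_lift_unique (cosyz_short_exact A) _ vu' vu _ => a; rewrite u'f uf.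
Qed.

Lemma sat_map_id A (f : {linear A -> A}) : (forall x, f x = x) ->
  forall z, sat_map f z = z.
Proof.
move=> f1 z; have [y <-] := sat_surj z.
rewrite (@sat_mapE _ _ f idfun idfun) ?fmap_id // => a.
by rewrite f1.
Qed.

Lemma sat_map_comp A B C (f : {linear A -> B}) (g : {linear B -> C}) (h : {linear A -> C}) :
  (forall x, h x = g (f x)) -> forall z, sat_map h z = sat_map g (sat_map f z).
Proof.
move=> hE z; have [y <-] := sat_surj z.
have [u [uf vu]] := cosyz_mapP f; have [u' [ug vu']] := cosyz_mapP g.
rewrite (sat_mapE uf vu) (sat_mapE ug vu').
rewrite (@sat_mapE _ _ h (cosyz_map g \o cosyz_map f) (u' \o u)).
- by rewrite (fmap_comp (f := cosyz_map f) (g := cosyz_map g)).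
- by move=> a; rewrite /= uf ug hE.
- by move=> x; rewrite /= vu vu'.
Qed.

Lemma sat_map_lin A B (c : R) (f g h : {linear A -> B}) :
  (forall x, h x = c *: f x + g x) ->
  forall z, sat_map h z = c *: sat_map f z + sat_map g z.
Proof.
move=> hE z; have [y <-] := sat_surj z.
have [u [uf vu]] := cosyz_mapP f; have [u' [ug vu']] := cosyz_mapP g.
rewrite (sat_mapE uf vu) (sat_mapE ug vu').
rewrite (@sat_mapE _ _ h (lincomb c (cosyz_map f) (cosyz_map g))
  (lincomb c u u')).
- by rewrite (fmap_lin (f := cosyz_map f) (g := cosyz_map g) (c := c)) // linearP.
- by move=> a; rewrite /= uf ug hE linearP.
- by move=> x; rewrite /= vu vu' linearP.
Qed.

(** The hypotheses say that 0 -> A -> B x C -> D -> 0 is exact.  Applying F to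
this sequence is how all the exactness properties of satellites are proved. *)
Lemma fmap_bicartesian A B C D (k1 : {linear A -> B}) (k2 : {linear A -> C})
    (g1 : {linear B -> D}) (g2 : {linear C -> D}) :
  (forall x, k1 x = 0 -> k2 x = 0 -> x = 0) ->
  (forall d, exists b c, g1 b - g2 c = d) ->
  (forall b c, g1 b = g2 c <-> exists x, k1 x = b /\ k2 x = c) ->
  forall y z, fmap F g1 y = fmap F g2 z ->
    exists x, fmap F k1 x = y /\ fmap F k2 x = z.
Proof.
move=> kinj gsurj gk y z yz.
have klin : linear (fun x => (k1 x, k2 x)) by move=> c x x'; rewrite !linearP.
have hlin : linear (fun x : B * C => g1 x.1 - g2 x.2).
  by move=> c x x'; rewrite (linearP g1) (linearP g2) opprD addrACA scalerBr.
pose k := mklin klin; pose h := mklin hlin.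
pose in1 := mklin (@pair_inl_linear R B C); pose in2 := mklin (@pair_inr_linear R B C).
pose p1 := mklin (@pair_fst_linear R B C); pose p2 := mklin (@pair_snd_linear R B C).
have kh : short_exact k h.
  split=> [||[b c]].
  - by apply: linear_inj => x [k1x k2x]; apply: kinj.
  - by move=> d; have [b [c]] := gsurj d; exists (b, c).
  - split=> [/eqP|[x [<- <-]]].
      by rewrite subr_eq0 => /eqP/gk[x [/= k1x k2x]]; exists x; rewrite /= k1x k2x.
    by apply/eqP; rewrite subr_eq0; apply/eqP/gk; exists x.
have hw : fmap F h (fmap F in1 y + fmap F in2 z) = 0.
  rewrite linearD !fmap_compE.
  rewrite (fmap_ext (g := g1)) => [|x]; last by rewrite /= linear0 subr0.
  rewrite (fmapZ (f := g2) (c := -1)) => [|x]; last by rewrite /= linear0 sub0r scaleN1r.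
  by rewrite yz scaleN1r subrr.
have [x xE] := fmap_exact kh hw; exists x; split.
  rewrite (fmap_comp (f := k) (g := p1)) // xE linearD !fmap_compE.
  by rewrite fmap_id // fmap0 // addr0.
rewrite (fmap_comp (f := k) (g := p2)) // xE linearD !fmap_compE.
by rewrite fmap0 // fmap_id // add0r.
Qed.

(** Write E(X) for the chosen injective module containing X.  The square formed
by E(B)/A, E(B)/B, E(C) and E(C)/C is bicartesian, so a class in F(E(B)/B) that
dies in the satellite at C comes from F(E(B)/A).  Since E(B) also contains A, a
lift E(B)/A -> E(A)/A of the identity of A turns this into a class in the
satellite at A; its image in the satellite at B is the given one because both
come from maps E(B) -> E(B) that agree on A. *)
Lemma sat_exact A B C (f : {linear A -> B}) (g : {linear B -> C}) :
  short_exact f g -> forall z, sat_map g z = 0 -> exists x, sat_map f x = z.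
Proof.
move=> fg; have [finj gsurj gf] := fg; move=> z; have [y <-] := sat_surj z.
have [u [uf vu]] := cosyz_mapP f; have [u' [ug vu']] := cosyz_mapP g.
rewrite (sat_mapE ug vu') => /sat_pi_eq0[e eE].
pose j : {linear A -> big_injective B} := @to_injective R B \o f.
have jinj : injective j by move=> a a' /to_injective_inj/finj.
have jq := short_exact_im jinj; set q := quotmod_pi _ in jq.
have [|r rE] := @linear_descend _ _ _ _ q (cosyz_pi B) (@quotmod_surj _ _ _).
  by move=> x /(short_exact0P jq)[a <-]; rewrite cosyz_pi0.
have [|k kE] := @linear_descend _ _ _ _ q u' (@quotmod_surj _ _ _).
  by move=> x /(short_exact0P jq)[a <-]; rewrite ug (short_exact0 _ fg) linear0.
have [u0 [t [u0j tE]]] := short_exact_lift idfun jq (@big_injective_injective R A)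
  (@cosyz_pi0 R A).
have [||||s [sy _]] := @fmap_bicartesian _ _ _ _ r k (cosyz_map g) (cosyz_pi C) _ _ _ y e.
- move=> x; have [b <-] := quotmod_surj x; rewrite -/q rE kE.
  move=> /(short_exact0P (cosyz_short_exact B))[b' <-]; rewrite ug.
  rewrite -(linear0 (@to_injective R C)) => /to_injective_inj/gf[a <-].
  exact: short_exact0 jq.
- by move=> d; have [c <-] := cosyz_surj d; exists 0, (- c); rewrite linear0 sub0r linearN opprK.
- move=> x c; split=> [|[b [<- <-]]]; last first.
    by have [b' <-] := quotmod_surj b; rewrite -/q rE kE vu'.
  have [b <-] := cosyz_surj x; rewrite vu' => /eqP; rewrite -subr_eq0 -linearB.
  move=> /eqP/(short_exact0P (cosyz_short_exact C))[c0 c0E].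
  have [b0 b0c] := gsurj c0.
  exists (q (b - to_injective b0)); rewrite rE kE !linearB cosyz_pi0 subr0 ug b0c c0E.
  by rewrite subKr.
- by [].
exists (sat_pi A (fmap F t s)); rewrite (sat_mapE uf vu) -sy.
rewrite !fmap_compE.
apply: (sat_lift_unique (u := u \o u0) (u' := idfun) jq) => x /=.
- by rewrite u0j uf.
- by rewrite tE vu.
- by rewrite rE.
Qed.

Definition satellite : half_exact_functor R :=
  HalfExactFunctor sat_map_id sat_map_comp sat_map_lin sat_exact.

(** The relevant part of the long exact sequence: the connecting map from F(C)
to the satellite at A is zero.  It is induced by a map C -> E(A)/A, and the
square formed by B, C, E(A) and E(A)/A is bicartesian. *)
Lemma satellite_surj A B C (f : {linear A -> B}) (g : {linear B -> C}) :
  short_exact f g -> (forall z : satellite A, z = 0) ->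
  forall y, exists x, fmap F g x = y.
Proof.
move=> fg SA0 y; have [finj gsurj gf] := fg.
have [u [d [uf dg]]] := short_exact_lift idfun fg (@big_injective_injective R A)
  (@cosyz_pi0 R A).
have /sat_pi_eq0[e eE] := SA0 (sat_pi A (fmap F d y)).
have [||||s [sy _]] := @fmap_bicartesian _ _ _ _ g u d (cosyz_pi A) _ _ _ y e.
- by move=> b /gf[a <-]; rewrite uf /= -[X in _ = X](linear0 (@to_injective R A));
  move=> /to_injective_inj->; rewrite linear0.
- by move=> q; have [x <-] := cosyz_surj q; exists 0, (- x); rewrite linear0 sub0r linearN opprK.
- move=> c x; split=> [|[b [<- <-]]]; last exact: dg.
  have [b <-] := gsurj c; rewrite dg => /eqP; rewrite -subr_eq0 -linearB.
  move=> /eqP/(short_exact0P (cosyz_short_exact A))[a aE].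
  exists (b - f a); rewrite !linearB (short_exact0 _ fg) subr0 uf /= aE.
  by rewrite subKr.
- by [].
by exists s.
Qed.

(** The kernel comes from F(C) through the connecting map.  With [d] from C to
E(A)/A inducing that map and [th] from C to E(B) the descent of the difference
of the two natural maps B -> E(B), the square formed by E(A) x C, E(A)/A, E(B)
and E(B)/B is bicartesian. *)
Lemma satellite_inj A B C (f : {linear A -> B}) (g : {linear B -> C}) :
  short_exact f g -> (forall z : F C, z = 0) ->
  forall z, fmap satellite f z = 0 -> z = 0.
Proof.
move=> fg FC0 z; have [finj gsurj gf] := fg; have [y <-] := sat_surj z.
have [w [uf vu]] := cosyz_mapP f.
rewrite [LHS](sat_mapE uf vu) => /sat_pi_eq0[e eE].
have [u [d [ua dg]]] := short_exact_lift idfun fg (@big_injective_injective R A)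
  (@cosyz_pi0 R A).
have [|th thg] := @linear_descend _ _ _ _ g
  (lincomb (-1) (@to_injective R B) (w \o u)) gsurj.
  by move=> b /gf[a <-]; rewrite /= ua /= uf scaleN1r addNr.
have k1lin : linear (fun x : big_injective A * C => cosyz_pi A x.1 + d x.2).
  by move=> c x x'; rewrite (linearP (cosyz_pi A)) (linearP d) addrACA scalerDr.
have k2lin : linear (fun x : big_injective A * C => w x.1 + th x.2).
  by move=> c x x'; rewrite (linearP w) (linearP th) addrACA scalerDr.
pose k1 := mklin k1lin; pose k2 := mklin k2lin.
have [||||s [sy _]] := @fmap_bicartesian _ _ _ _ k1 k2 (cosyz_map f) (cosyz_pi B) _ _ _ y e.
- move=> [a' c]; have [b <-] := gsurj c; rewrite /= dg thg /= scaleN1r -linearD.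
  move=> /(short_exact0P (cosyz_short_exact A))[a aE].
  rewrite addrCA -linearD -aE uf addrC => /eqP; rewrite subr_eq0 => /eqP/to_injective_inj ab.
  move: aE; rewrite -ab ua (short_exact0 _ fg) => /(congr1 (fun x => x - to_injective a)).
  by rewrite subrr addrK => <-.
- by move=> q; have [x <-] := cosyz_surj q; exists 0, (- x); rewrite linear0 sub0r linearN opprK.
- move=> x b'; split=> [|[[a' c] [<- <-]]]; last first.
    have [b <-] := gsurj c; rewrite /= dg thg /= scaleN1r !linearD linearN !vu.
    by rewrite cosyz_pi0 oppr0 add0r.
  have [a' <-] := cosyz_surj x; rewrite vu => /eqP; rewrite -subr_eq0 -linearB.
  move=> /eqP/(short_exact0P (cosyz_short_exact B))[b bE].
  exists (a' - u b, g b); rewrite /= dg thg /= linearB subrK; split=> //.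
  by rewrite linearB scaleN1r bE addrCA subrK opprB subrK.
- by [].
pose p1 := mklin (@pair_fst_linear R (big_injective A) C).
pose p2 := mklin (@pair_snd_linear R (big_injective A) C).
apply/sat_pi_eq0; exists (fmap F p1 s); rewrite -sy.
rewrite (fmap_lin (c := 1) (f := cosyz_pi A \o p1) (g := d \o p2) (h := k1)).
  by rewrite scale1r -[fmap F (d \o p2) s]fmap_compE [fmap F p2 s]FC0 linear0 addr0 fmap_compE.
by move=> x; rewrite scale1r.
Qed.

(** An injective module is a direct summand of any module containing it, so the
projection to the quotient has a section [s]. *)
Lemma satellite_injective_module J (z : satellite J) : injective_module J -> z = 0.
Proof.
move=> Jinj; have [y <-] := sat_surj z.
have [h hK] := Jinj _ _ (@to_injective R J) idfun (@to_injective_inj R J).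
have [|s sE] := @linear_descend _ _ _ _ (cosyz_pi J)
  (lincomb (-1) (@to_injective R J \o h) idfun) (@cosyz_surj R J).
  move=> x /(short_exact0P (cosyz_short_exact J))[a <-] /=.
  by rewrite hK scaleN1r addNr.
apply/sat_pi_eq0; exists (fmap F s y).
rewrite !fmap_compE fmap_id // => q.
have [x <-] := cosyz_surj q.
by rewrite /= sE /= linearP /= cosyz_pi0 scaler0 add0r.
Qed.

End Satellite.

(** * Local cohomology as an iterated satellite *)

Section LocalCohomologyFunctors.
Context (R : comNzRingType) (a : ideal R).
Implicit Types (A B C V : lmodType R).

Lemma in_torsion V (x : V) : x \in torsion a V <->
  exists n, forall c : R, c \in ideal_exp a n -> c *: x = 0.
Proof. by split=> [/asboolP|?]; last apply/asboolP. Qed.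

Lemma torsion_inj A B (f : {linear A -> B}) x :
  injective f -> f x \in torsion a B -> x \in torsion a A.
Proof.
move=> finj /in_torsion[n xn]; apply/in_torsion; exists n => c cn.
by apply: finj; rewrite linearZ_LR linear0 xn.
Qed.

Lemma torsion_map_id A (f : {linear A -> A}) :
  (forall x, f x = x) -> forall y, torsion_map a f y = y.
Proof. by move=> f1 y; apply: val_inj; rewrite /= f1. Qed.

Lemma torsion_map_comp A B C (f : {linear A -> B}) (g : {linear B -> C})
    (h : {linear A -> C}) : (forall x, h x = g (f x)) ->
  forall y, torsion_map a h y = torsion_map a g (torsion_map a f y).
Proof. by move=> hE y; apply: val_inj; rewrite /= hE. Qed.

Lemma torsion_map_lin A B (c : R) (f g h : {linear A -> B}) :
  (forall x, h x = c *: f x + g x) ->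
  forall y, torsion_map a h y = c *: torsion_map a f y + torsion_map a g y.
Proof. by move=> hE y; apply: val_inj; rewrite /= hE. Qed.

Lemma torsion_map_exact A B C (f : {linear A -> B}) (g : {linear B -> C}) :
  short_exact f g -> forall y, torsion_map a g y = 0 ->
  exists x, torsion_map a f x = y.
Proof.
move=> fg y /(congr1 val) /= /(short_exact0P fg)[x xy].
have xT : x \in torsion a A.
  by case: fg => finj _ _; apply: (torsion_inj finj); rewrite xy; exact: (valP y).
by exists (Sub x xT); apply: val_inj.
Qed.

Definition torsion_functor : half_exact_functor R :=
  HalfExactFunctor torsion_map_id torsion_map_comp torsion_map_lin torsion_map_exact.

Fixpoint derived_torsion i : half_exact_functor R :=
  if i is j.+1 then satellite (derived_torsion j) else torsion_functor.

Lemma derived_torsion_torsion i V (z : derived_torsion i V) (x : R) : x \in a ->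
  exists n, x ^+ n *: z = 0.
Proof.
move=> xa; elim: i V z => [|i IH] V z.
  have /in_torsion[n zn] := valP z; exists n; apply: val_inj; exact/zn/ideal_expX.
have [y <-] := sat_surj z; have [n yn] := IH _ y.
by exists n; rewrite -linearZ yn linear0.
Qed.

Definition isomorphism A B (f : {linear A -> B}) :=
  injective f /\ forall y, exists x, f x = y.

Lemma isomorphism_comp A B C (f : {linear A -> B}) (g : {linear B -> C}) :
  isomorphism f -> isomorphism g -> isomorphism (g \o f : {linear A -> C}).
Proof.
move=> [finj fs] [ginj gs]; split=> [|z]; first exact: inj_comp.
by have [y <-] := gs z; have [x <-] := fs y; exists x.
Qed.

Lemma isomorphism_descend A B C (p : {linear A -> B}) (q : {linear A -> C}) :
  (forall b, exists x, p x = b) -> (forall c, exists x, q x = c) ->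
  (forall x, p x = 0 <-> q x = 0) -> exists h : {linear B -> C}, isomorphism h.
Proof.
move=> ps qs pq; have [|h hE] := @linear_descend _ _ _ _ p q ps.
  by move=> b /pq.
exists h; split=> [|c]; last by have [x <-] := qs c; exists (p x).
by apply: linear_inj => b; have [x <-] := ps b; rewrite hE => /pq.
Qed.

(** The satellites of positive order vanish on injective modules, so the
satellite of order i + 2 of a module is that of order i + 1 of its cosyzygy. *)
Lemma dimension_shift V i n m : m = (i + n)%N ->
  exists h : {linear derived_torsion 1 (cosyzygy V m) ->
                     derived_torsion i.+1 (cosyzygy V n)}, isomorphism h.
Proof.
elim: i n => [|i IH] n mE.
  by rewrite mE; exists idfun; split=> // y; exists y.
have [|h hiso] := IH n.+1; first by rewrite mE addSnnS.
pose p := sat_pi (derived_torsion i.+1) (cosyzygy V n).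
exists (p \o h : {linear _ -> derived_torsion i.+2 (cosyzygy V n)}).
apply: isomorphism_comp => //; split; last exact: sat_surj.
apply: linear_inj => y /sat_pi_eq0[x <-].
rewrite [x](satellite_injective_module (F := derived_torsion i)) ?linear0 //.
exact: big_injective_injective.
Qed.

(** The module A plays the part of the cocycles, and p that of the projection
onto cohomology classes. *)
Lemma cohomology_iso (C : cochain_complex R) n A B (t : {linear A -> C n})
    (p : {linear A -> B}) :
  injective t -> (forall x, cx_diff C n x = 0 <-> exists y, t y = x) ->
  (forall b, exists x, p x = b) ->
  (forall x, p x = 0 <-> t x \in coboundaries C n) ->
  exists h : {linear B -> cohomology C n}, isomorphism h.
Proof.
move=> tinj tker ps pker.
have [|k kE] := @linear_corestrict _ _ _ _ (submod_val (kermod (cx_diff C n))) t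
  (@submod_val_inj _ _ _).
  move=> x; have xk : t x \in kermod (cx_diff C n).
    by rewrite in_kermod; apply/eqP/tker; exists x.
  by exists (Sub (t x) xk).
apply: (@isomorphism_descend _ _ _ p (quotmod_pi _ \o k)) => //= [c|x].
  have [y <-] := quotmod_surj c; have /eqP/tker[x xy] := valP y.
  by exists x; congr quotmod_pi; apply: submod_val_inj; rewrite kE xy.
rewrite pker -kE; split=> [kx|/quotmod_eq0 //].
exact/quotmod_eq0.
Qed.

Lemma to_injective_torsion_inj V : injective (torsion_map a (@to_injective R V)).
Proof. by move=> x y /(congr1 val) /to_injective_inj xy; exact: val_inj. Qed.

Lemma torsion_inj_diff_eq0 V n (x : submod_of (torsion a (inj_obj V n))) :
  torsion_map a (inj_diff V n) x = 0 <->
  exists y, torsion_map a (@to_injective R (cosyzygy V n)) y = x.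
Proof.
have E : torsion_map a (inj_diff V n) x = 0 <-> inj_diff V n (val x) = 0.
  by split=> [/(congr1 val)//|x0]; apply: val_inj.
rewrite E inj_diff_eq0; split=> [[y yx]|[y <-]]; last by exists (val y).
have yT : y \in torsion a (cosyzygy V n).
  by have := valP x; rewrite -[X in X \in _]yx => /(torsion_inj (@to_injective_inj R _)).
by exists (Sub y yT); apply: val_inj.
Qed.

Lemma local_cohomology0_iso V :
  exists h : {linear derived_torsion 0 V -> local_cohomology a 0 V}, isomorphism h.
Proof.
apply: (@cohomology_iso (torsion_complex a (standard_injective_resolution V)) 0
  _ _ (torsion_map a (@to_injective R V)) idfun).
- exact: to_injective_torsion_inj.
- exact: (@torsion_inj_diff_eq0 V 0).
- by move=> b; exists b.
- move=> x; split=> [x0|/eqP].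
    by have -> : x = 0 := x0; rewrite linear0; apply/eqP.
  by rewrite -(linear0 (torsion_map a (@to_injective R V))) => /to_injective_torsion_inj.
Qed.

Lemma local_cohomologyS_iso V m :
  exists h : {linear derived_torsion 1 (cosyzygy V m) -> local_cohomology a m.+1 V},
    isomorphism h.
Proof.
apply: (@cohomology_iso (torsion_complex a (standard_injective_resolution V)) m.+1
  _ _ (torsion_map a (@to_injective R (cosyzygy V m.+1)))
  (sat_pi (derived_torsion 0) (cosyzygy V m))).
- exact: to_injective_torsion_inj.
- exact: (@torsion_inj_diff_eq0 V m.+1).
- exact: sat_surj.
- move=> x; rewrite sat_pi_eq0; split=> [[e <-]|/asboolP[e ek]].
    by apply/asboolP; exists e; apply: val_inj.
  by exists e; apply: to_injective_torsion_inj; rewrite -ek; apply: val_inj.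
Qed.

Lemma local_cohomology_iso i V :
  exists h : {linear derived_torsion i V -> local_cohomology a i V}, isomorphism h.
Proof.
case: i => [|i]; first exact: local_cohomology0_iso.
have [h [hinj hsurj]] := @dimension_shift V i 0 i (esym (addn0 i)).
have [k [kinj ksurj]] := local_cohomologyS_iso V i.
have [|g gE] := @linear_corestrict _ _ _ _ h idfun hinj.
  by move=> x; apply: hsurj.
exists (k \o g : {linear derived_torsion i.+1 V -> _}).
apply: isomorphism_comp; last by split.
split=> [x y xy|y]; first by rewrite -[x]gE xy gE.
by exists (h y); apply: hinj; rewrite gE.
Qed.

End LocalCohomologyFunctors.

(** * Injectivity of torsion in an injective module *)

Section Baer.
Context (R : comNzRingType) (E : lmodType R).
Implicit Type V : lmodType R.

(** Graph of a linear map from a submodule of V to E. *)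
Definition linear_graph V (G : set (V * E)) :=
  [/\ G 0, forall (c : R) u v, G u -> G v -> G (c *: u + v) &
      forall e, G (0, e) -> e = 0].

Hypothesis E_baer : forall (I : ideal R) (f : {linear submod_of I -> E}),
  exists e, forall x, f x = (val x : R) *: e.

Lemma linear_graph_unique V (G : set (V * E)) v e e' :
  linear_graph G -> G (v, e) -> G (v, e') -> e = e'.
Proof.
case=> _ GD G0 Ge Ge'; apply/esym/eqP; rewrite -subr_eq0; apply/eqP/G0.
have := GD (-1) _ _ Ge Ge'; congr G; congr pair; rewrite /= scaleN1r.
  exact: addNr.
exact: addrC.
Qed.

(** The scalars c for which c v is in the domain of G form an ideal I, and G
defines a linear map on I; by hypothesis it is multiplication by some e, which
is an admissible value at v. *)
Lemma linear_graph_adjoin V (G : set (V * E)) (v : V) : linear_graph G ->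
  exists2 G', linear_graph G' & G `<=` G' /\ exists e, G' (v, e).
Proof.
move=> gG; have [G0 GD Gf] := gG.
have Icl : submod_closed [pred c : R^o | `[< exists e, G ((c : R) *: v, e) >]].
  split=> [|b c d /asboolP[e Ge] /asboolP[e' Ge']]; apply/asboolP.
    by exists 0; rewrite scale0r.
  by exists (b *: e + e'); rewrite scalerDl -scalerA; apply: GD Ge Ge'.
pose I : ideal R := Submod Icl.
have /choice[f fP] (c : submod_of I) : exists e, G ((val c : R) *: v, e).
  by apply/asboolP; exact: (valP c).
have flin : linear f.
  move=> c x y; apply: (linear_graph_unique gG (fP _)).
  have := GD c _ _ (fP x) (fP y); congr G; congr pair.
  by rewrite /= scalerA -scalerDl.
have [e eP] := E_baer (mklin flin).
have GI c e' : G (c *: v, e') -> e' = c *: e.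
  move=> Ge'; have cI : c \in I by apply/asboolP; exists e'.
  have <- : f (Sub c cI) = c *: e := eP (Sub c cI).
  exact: (linear_graph_unique gG Ge' (fP (Sub c cI))).
exists [set u | exists c, G (u - (c *: v, c *: e))]; last first.
  split=> [u Gu|]; first by exists 0; rewrite !scale0r subr0.
  by exists e, 1; rewrite !scale1r subrr.
split=> [|b u u' [c Gu] [c' Gu']|d [c]].
- by exists 0; rewrite !scale0r subr0.
- exists (b * c + c'); have := GD b _ _ Gu Gu'; congr G.
  rewrite scalerBr addrACA -opprD; congr (_ - _); congr pair => /=;
    by rewrite scalerA scalerDl.
- rewrite (_ : _ - _ = (- c *: v, d - c *: e)); last first.
    by congr pair; rewrite /= sub0r scaleNr.
  by move=> /GI/eqP; rewrite scaleNr subr_eq addNr => /eqP.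
Qed.

(** A maximal graph containing G exists by Zorn, and is everywhere defined by
[linear_graph_adjoin]. *)
Lemma linear_graph_extension V (G : set (V * E)) : linear_graph G ->
  exists h : {linear V -> E}, forall v e, G (v, e) -> h v = e.
Proof.
move=> gG.
have [F Fsub Ftot|A [gA Amax]] :=
    @Zorn_bigcup _ (fun X => linear_graph (X `|` G)).
  have GF u : (\bigcup_(X in F) X `|` G) u ->
      exists Y, [/\ linear_graph Y, Y u,
        Y `<=` \bigcup_(X in F) X `|` G & Y = G \/ exists2 X, F X & Y = X `|` G].
    move=> [[X FX Xu]|Gu]; last by exists G; split=> //; left.
    exists (X `|` G); split; [exact: Fsub| by left | |by right; exists X].
    by apply: setSU => x Xx; exists X.
  split=> [|c u v|d /GF[Y [[_ _ Yf] /Yf -> _ _]]] //; first by right; case: gG.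
  move=> /GF[Y [gY Yu YF Yc]] /GF[Z [gZ Zv ZF Zc]].
  suff [YZ|ZY] : Y `<=` Z \/ Z `<=` Y.
  - by apply: ZF; case: gZ => _ + _; apply=> //; apply: YZ.
  - by apply: YF; case: gY => _ + _; apply=> //; apply: ZY.
  case: Yc => [->|[X FX ->]]; case: Zc => [->|[X' FX' ->]]; first by left.
  + by left=> x; right.
  + by right=> x; right.
  + by case: (Ftot X X' FX FX') => XX; [left|right]; apply: setSU.
have tot v : exists e, (A `|` G) (v, e).
  have [G' gG' [sG' [e G'e]]] := linear_graph_adjoin v gA.
  exists e; apply: contrapT => ne; apply: (Amax G').
    split=> [x Ax|/(_ _ G'e) Ae]; first by apply: sG'; left.
    by apply: ne; left.
  by rewrite (iffRL (setUidPl _ _)) // => x Gx; apply: sG'; right.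
have [h hP] := choice tot.
have hlin : linear h.
  move=> c x y; apply: (linear_graph_unique gA (hP _)).
  by case: gA => _ /(_ c _ _ (hP x) (hP y)).
exists (mklin hlin) => v e Gve; apply: (linear_graph_unique gA (hP v)); by right.
Qed.

Lemma baer_injective : injective_module E.
Proof.
move=> U V f g finj.
have gG : linear_graph [set u | exists x, u = (f x, g x)].
  split=> [|c _ _ [x ->] [y ->]|e [x []]].
  - by exists 0; rewrite !linear0.
  - by exists (c *: x + y); rewrite !linearP.
  - by rewrite -(linear0 f) => /finj <- ->; rewrite linear0.
have [h hP] := linear_graph_extension gG.
by exists h => x; apply: hP; exists x.
Qed.
End Baer.

Section InjectiveTorsion.
Context (R : comNzRingType) (RN : noetherian R).
Implicit Types (I J K a : ideal R) (V : lmodType R).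

Lemma torsionP a V (x : V) : x \in torsion a V <->
  forall c : R, c \in a -> exists k, c ^+ k *: x = 0.
Proof.
split=> [/in_torsion[n xn] c ca|H]; first by exists n; apply/xn/ideal_expX.
have [|m mP] := @ideal_exp_sub R a (elt_annihilator x) RN.
  by move=> c /H[k ck]; exists k; apply/eqP.
by apply/in_torsion; exists m => c /mP/eqP.
Qed.

(** By Baer it is enough to extend a map f from an ideal I to the torsion of E.
Let K be an ideal maximal among those whose intersection with I is ker f.  Each
x in a has a power in K: if x^n kills f(I), and (K : x^k) is stationary from k
on, then K + (x^k) still meets I in ker f.  So K contains a power of a.  As I/ker f
embeds in R/K, injectivity of E gives e in E with f(x) = x e on I and K e = 0,
and e is torsion.  That K contains a power of a is a form
of the Artin-Rees lemma. *)
Lemma torsion_injective a (E : lmodType R) :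
  injective_module E -> injective_module (submod_of (torsion a E)).
Proof.
move=> Einj; apply: baer_injective => I f.
pose K0 := immod (submod_val I \o submod_val (kermod f)).
have K0P (x : submod_of I) : val x \in K0 <-> f x = 0.
  rewrite in_immod; split=> [[y /val_inj <-]|fx]; first exact/eqP/(valP y).
  by have xk : x \in kermod f by [rewrite in_kermod fx]; exists (Sub x xk).
pose P (K : ideal R) := {subset K0 <= K} /\
  forall x : submod_of I, val x \in K -> val x \in K0.
have [K [[K0K KK0] Kmax]] := ideal_maximal RN (ex_intro P K0 (conj (fun x => id) (fun x => id))).
have [m mP] : exists m, {subset ideal_exp a m <= K}.
  apply: (ideal_exp_sub RN) => x xa.
  have [n nP] : exists n, forall u : submod_of I, x ^+ n *: f u = 0.
    have [||n nP] := @fg_exhaust _ _ (fun n => kermod (scale_map _ (x ^+ n) \o f)) (RN I).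
    - move=> k l /subnK <- u; rewrite !in_kermod /= => /eqP xku.
      by rewrite exprD -scalerA xku scaler0.
    - move=> u; have /torsionP/(_ x xa)[k xk] := valP (f u).
      by exists k; rewrite in_kermod; apply/eqP; apply: val_inj.
    - by exists n => u; apply/eqP/nP.
  have [_ [[k ->] kmax]] := ideal_maximal RN
    (ex_intro (fun J => exists k, J = colon K (x ^+ k)) _ (ex_intro _ 0%N erefl)).
  exists k; apply: (Kmax (adjoin K (x ^+ k))); last exact: mem_adjoin.
    split=> [y /K0K|y /in_adjoin[u [v [vK yE]]]]; first exact: subset_adjoin.
    have xy : x ^+ n * (val y : R) \in K.
      apply: K0K; rewrite -[_ * _]/(val (x ^+ n *: y)); apply/K0P.
      by rewrite linearZ /= nP.
    have uk : u \in colon K (x ^+ k).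
      apply: (kmax (colon K (x ^+ (n + k)))); first by exists (n + k)%N.
        by move=> r; rewrite !(@in_colon R) exprD mulrCA; exact: ideal_mulr_closed.
      rewrite (@in_colon R) exprD mulrCA.
      have -> : u * x ^+ k = (val y : R) - v by rewrite yE addrK.
      by rewrite mulrBr; apply: idealB => //; exact: ideal_mulr_closed.
    by apply: KK0; rewrite yE; apply: idealD.
  by move=> y; exact: subset_adjoin.
pose p : {linear submod_of I -> quotmod K} := quotmod_pi K \o submod_val I.
have [g gsurj gE] := image_factorization p.
have [|h hE] := linear_descend (h := submod_val _ \o f) gsurj.
  move=> x gx0; have : p x = 0 by rewrite -gE gx0 linear0.
  by move=> /quotmod_eq0/KK0/K0P/= ->.
have [H HE] := Einj _ _ (submod_val (immod p)) h (@submod_val_inj _ _ _).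
pose e := H (quotmod_pi K 1).
have Hpi (r : R) : H (quotmod_pi K r) = r *: e.
  by rewrite -linearZ -linearZ /= -[r *: 1]/(r * 1) mulr1.
have eT : e \in torsion a E.
  apply/in_torsion; exists m => c /mP cK.
  by rewrite -Hpi (iffRL (quotmod_eq0 _ _)) ?linear0.
exists (Sub e eT) => x; apply: val_inj.
by rewrite -[LHS](hE x) -HE gE /= Hpi.
Qed.

(** A torsion module V embeds in the torsion G of an injective module E
containing it; G is injective by [torsion_injective] and G/V is again torsion, so
the vanishing follows by dimension shifting.  In degree one it says that every
element of E whose class in E/V is torsion is itself torsion. *)
Lemma derived_torsion_torsion_module a V i (z : derived_torsion a i.+1 V) :
  (forall x : V, x \in torsion a V) -> z = 0.
Proof.
move=> Vt; elim: i V Vt z => [|i IH] V Vt z.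
  have [y <-] := sat_surj z; apply/sat_pi_eq0.
  have [e ey] := cosyz_surj (val y).
  have eT : e \in torsion a (big_injective V).
    apply/torsionP => c ca; have /torsionP/(_ c ca)[k ck] := valP y.
    have : cosyz_pi V (c ^+ k *: e) = 0 by rewrite linearZ /= ey.
    move=> /(short_exact0P (cosyz_short_exact V))[v vE].
    have /torsionP/(_ c ca)[l cl] := Vt v; exists (l + k)%N.
    by rewrite exprD -scalerA -vE -linearZ cl linear0.
  by exists (Sub e eT); apply: val_inj.
pose E := big_injective V.
have [|j jE] := @linear_corestrict _ _ _ _ (submod_val (torsion a E)) (@to_injective R V)
  (@submod_val_inj _ _ _).
  move=> v; have vT : to_injective v \in torsion a E.
    apply/torsionP => c ca; have /torsionP/(_ c ca)[l cl] := Vt v; exists l.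
    by rewrite -linearZ cl linear0.
  by exists (Sub (to_injective v) vT).
have jinj : injective j by move=> x y xy; apply: to_injective_inj; rewrite -!jE xy.
apply: (satellite_inj (F := derived_torsion a i.+1) (short_exact_im jinj)).
  apply: IH => q; have [x <-] := quotmod_surj q.
  apply/torsionP => c ca; have /torsionP/(_ c ca)[k ck] := valP x; exists k.
  have cx0 : c ^+ k *: x = 0 by exact: val_inj.
  by rewrite -linearZ_LR cx0 linear0.
apply: (satellite_injective_module (F := derived_torsion a i.+1)).
exact/torsion_injective/big_injective_injective.
Qed.

End InjectiveTorsion.


(** * Prime filtrations and vanishing above the dimension *)

Section Devissage.
Context (R : comNzRingType) (RN : noetherian R).
Implicit Types (I J b p : ideal R) (A B C V : lmodType R).

Definition killed_by I V := forall (c : R) (x : V), c \in I -> c *: x = 0.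

Definition generates V (v : V) := forall x : V, exists r : R, x = r *: v.

Lemma in_immod_gen V (v w : V) : w \in immod (mulr_gen v) <-> exists r : R, w = r *: v.
Proof. by rewrite in_immod; split=> -[r rE]; exists r. Qed.

Lemma mem_immod_gen V (v : V) : v \in immod (mulr_gen v).
Proof. by apply/in_immod_gen; exists 1; rewrite scale1r. Qed.

Definition generator V (v : V) : submod_of (immod (mulr_gen v)) :=
  Sub v (mem_immod_gen v).

Lemma generatorP V (v : V) : generates (generator v).
Proof.
move=> x; have /in_immod_gen[r rE] := valP x.
by exists r; apply: val_inj.
Qed.

Lemma generator_annihilator V (v : V) :
  elt_annihilator (generator v) = elt_annihilator v.
Proof.
apply: submod_eq => r; apply/idP/idP => /in_elt_annihilator rv.
  by apply/in_elt_annihilator; have := congr1 val rv.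
by apply/in_elt_annihilator; apply: val_inj.
Qed.

Lemma not_prime_factors b : (1 : R) \notin b -> ~ prime_ideal b ->
  exists x y : R, [/\ x \notin b, y \notin b & x * y \in b].
Proof.
move=> b1 nprime; apply: contrapT => nxy; apply: nprime; split=> // x y xyb.
apply: contrapT => /negP; rewrite negb_or => /andP[xb yb].
by apply: nxy; exists x, y.
Qed.

Section PrimeFiltration.
Variable P : lmodType R -> Prop.
Hypothesis P0 : forall V, (forall x : V, x = 0) -> P V.
Hypothesis Pext : forall A B C (f : {linear A -> B}) (g : {linear B -> C}),
  short_exact f g -> P A -> P C -> P B.

(** Noetherian induction on the annihilator of the generator v.  If it is not
prime, choose x and y outside it with x y inside: the submodule generated by
x v is killed by y, the quotient by it is killed by x, and so both have a larger
annihilator. *)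
Lemma cyclic_devissage I :
  (forall V (v : V), generates v -> prime_ideal (elt_annihilator v) ->
    {subset I <= elt_annihilator v} -> P V) ->
  forall V (v : V), generates v -> {subset I <= elt_annihilator v} -> P V.
Proof.
move=> Pp V v; have [b bE] : exists b, b = elt_annihilator v by exists (elt_annihilator v).
elim/(ideal_ind RN): b => b IH in V v bE *; move=> vgen Iv.
have [/in_elt_annihilator|v1] := boolP ((1 : R) \in elt_annihilator v).
  by rewrite scale1r => v0; apply: P0 => x; have [r ->] := vgen x; rewrite v0 scaler0.
have [|nprime] := pselect (prime_ideal (elt_annihilator v)); first by move=> ?; apply: (Pp V v).
have [x [y [xb yb xyb]]] := not_prime_factors v1 nprime.
pose w := x *: v; apply: (Pext (short_exact_submod (immod (mulr_gen w)))).
  have wann (r : R) : r \in elt_annihilator (generator w) <-> r * x \in elt_annihilator v.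
    by rewrite generator_annihilator !in_elt_annihilator scalerA.
  have sub : {subset elt_annihilator v <= elt_annihilator (generator w)}.
    move=> r rv; apply/wann; rewrite mulrC. exact: ideal_mulr_closed.
  apply: (IH (elt_annihilator (generator w)) y) erefl (@generatorP _ w) _; rewrite ?bE //.
  - by apply/wann; rewrite mulrC.
  - by move=> r /Iv/sub.
pose W := immod (mulr_gen w).
have qann (r : R) : r \in elt_annihilator (quotmod_pi W v) <->
    exists s, r - s * x \in elt_annihilator v.
  rewrite in_elt_annihilator -linearZ quotmod_eq0 in_immod_gen.
  split=> -[s] => [sE|/in_elt_annihilator sE]; exists s; last first.
    by move/eqP: sE; rewrite scalerBl subr_eq0 -scalerA => /eqP.
  by apply/in_elt_annihilator; rewrite scalerBl -scalerA sE subrr.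
have sub : {subset elt_annihilator v <= elt_annihilator (quotmod_pi W v)}.
  by move=> r rv; apply/qann; exists 0; rewrite mul0r subr0.
apply: (IH (elt_annihilator (quotmod_pi W v)) x) erefl _ _; rewrite ?bE //.
- by apply/qann; exists 1; rewrite mul1r subrr ideal0.
- move=> z; have [u <-] := quotmod_surj z; have [r ->] := vgen u.
  by exists r; rewrite linearZ.
- by move=> r /Iv/sub.
Qed.

(** Every finitely generated module has a filtration with quotients R/p: a
property that is stable under extensions need only be checked on these. *)
Lemma prime_devissage I :
  (forall V (v : V), generates v -> prime_ideal (elt_annihilator v) ->
    {subset I <= elt_annihilator v} -> P V) ->
  forall V, finitely_generated V -> killed_by I V -> P V.
Proof.
move=> Pp V [s]; have [n sn] : exists n, n = size s by exists (size s).
elim: n => [|n IH] in V s sn *.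
  have -> : s = [::] by apply/size0nil.
  by move=> sP _; apply: P0 => x; apply/eqP; rewrite -spanmod_nil.
case: s sn => // y s /succn_inj sn sP IV.
apply: (Pext (short_exact_submod (immod (mulr_gen y)))).
  apply: (cyclic_devissage Pp (@generatorP _ y)); rewrite generator_annihilator.
  by move=> r rI; apply/in_elt_annihilator/IV.
set W := immod _.
apply: (IH _ (map (quotmod_pi W) s)); first by rewrite size_map.
  move=> z; have [x <-] := quotmod_surj z.
  have /spanmod_cons[c [u [us ->]]] := sP x.
  apply/spanmod_map; exists u => //; apply/quotmod_piP.
  by rewrite opprD addrCA subrr addr0 rpredN rpredZ ?mem_immod_gen.
move=> c z cI; have [x <-] := quotmod_surj z.
by rewrite -linearZ IV ?linear0.
Qed.
End PrimeFiltration.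

Lemma functor_devissage (F : half_exact_functor R) I :
  (forall V (v : V), generates v -> prime_ideal (elt_annihilator v) ->
    {subset I <= elt_annihilator v} -> forall z : F V, z = 0) ->
  forall V, finitely_generated V -> killed_by I V -> forall z : F V, z = 0.
Proof.
move=> Fp; apply: (prime_devissage (P := fun V => forall z : F V, z = 0)) Fp => [V V0 z|].
  exact: fmap_zero_module.
move=> A B C f g fg A0 C0 z; have [x <-] := fmap_exact fg (C0 (fmap F g z)).
by rewrite [x]A0 linear0.
Qed.

End Devissage.

Section Dimension.
Context (R : comNzRingType).
Implicit Types (I J p q : ideal R).

(** That dim R/I < n, the dimension of the zero ring being minus infinity. *)
Definition dim_lt I n := forall m, prime_chain_length I m -> (m < n)%N.

Lemma prime_chain_length_sub I J n : {subset I <= J} ->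
  prime_chain_length J n -> prime_chain_length I n.
Proof.
move=> IJ [p [pJ pS]]; exists p; split=> // i /pJ[pi Jp]; split=> // x /IJ.
exact: Jp.
Qed.

Lemma prime_chain_length0 I p : prime_ideal p -> {subset I <= p} -> prime_chain_length I 0.
Proof. by move=> pp Ip; exists (fun=> p); split. Qed.

Lemma prime_chain_lengthS I p J n : prime_ideal p -> {subset I <= p} ->
  {subset p <= J} -> ~ {subset J <= p} ->
  prime_chain_length J n -> prime_chain_length I n.+1.
Proof.
move=> pp Ip pJ nJp [c [cJ cS]]; exists (fun i => if i is j.+1 then c j else p).
split=> [[|i] //|[|i]] lin.
- have [ci Ji] := cJ i lin; split=> // x /Ip/pJ; exact: Ji.
- have [_ J0] := cJ 0%N isT; split=> [x /pJ /J0 //|c0p]; apply: nJp => x /J0.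
  exact: c0p.
- exact: cS.
Qed.

Lemma dim_lt_sub I J n : {subset I <= J} -> dim_lt I n -> dim_lt J n.
Proof. by move=> IJ In m /(prime_chain_length_sub IJ)/In. Qed.

Lemma dim_lt_prime I p J n : prime_ideal p -> {subset I <= p} ->
  {subset p <= J} -> ~ {subset J <= p} -> dim_lt I n.+1 -> dim_lt J n.
Proof. by move=> pp Ip pJ nJp In m /(prime_chain_lengthS pp Ip pJ nJp)/In. Qed.

(** When dim R/I <= d these are the primes p over I with dim R/p = d. *)
Definition top_prime I d p :=
  [/\ prime_ideal p, {subset I <= p} & prime_chain_length p d].

Lemma top_prime_minimal I d p q : dim_lt I d.+1 -> top_prime I d p ->
  prime_ideal q -> {subset I <= q} -> {subset q <= p} -> p = q.
Proof.
move=> Id [pp Ip pd] qq Iq qp; apply: contrapT => npq.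
suff /Id : prime_chain_length I d.+1 by rewrite ltnn.
apply: (prime_chain_lengthS qq Iq qp _ pd) => pq; apply: npq.
by apply: submod_eq => x; apply/idP/idP; [exact: pq | exact: qp].
Qed.

Lemma dim_lt_avoid I d J : dim_lt I d.+1 -> {subset I <= J} ->
  (forall p, top_prime I d p -> ~ {subset J <= p}) -> dim_lt J d.
Proof.
move=> Id IJ Jtop m mJ; have := Id m (prime_chain_length_sub IJ mJ).
rewrite ltnS leq_eqVlt => /orP[/eqP mE|//].
have [c [cJ cS]] := mJ; have [c0 Jc0] := cJ 0%N isT.
exfalso; apply: (Jtop (c 0%N)) => //; split=> //; first by move=> x /IJ/Jc0.
rewrite -mE; exists c; split=> // i im; split; first by have [] := cJ i im.
elim: i im => [|i IH] im x //.
by move=> /(IH (ltnW im)); apply: (cS i im).1.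
Qed.

End Dimension.

Section Vanishing.
Context (R : comNzRingType) (RN : noetherian R) (a : ideal R).
Implicit Types (I J b p : ideal R) (A B C V : lmodType R).

Local Notation H := (derived_torsion a).

(** Grothendieck vanishing.  By induction on i and filtration it is enough to
treat A = R/p.  If a is contained in p, then A is a-torsion.  Otherwise some x
in a acts injectively on A, and A/xA has smaller dimension; by the long exact
sequence x acts injectively on the cohomology of A, each element of which is
killed by a power of x. *)
Lemma derived_torsion_vanish i I V : dim_lt I i -> finitely_generated V ->
  killed_by I V -> forall z : H i V, z = 0.
Proof.
elim: i => [|i IH] in I V *; move=> Ii; apply: (functor_devissage RN).
  by move=> A v _ pv Iv; have /Ii := prime_chain_length0 pv Iv.
move=> A v vgen pv Iv z.
have [av|/existsNP[x /not_implyP[xa xv]]] :=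
    pselect (forall x : R, x \in a -> x \in elt_annihilator v).
  apply: (derived_torsion_torsion_module RN) => y; apply/torsionP => // c /av.
  move=> /in_elt_annihilator cv; exists 1%N; have [r ->] := vgen y.
  by rewrite expr1 scalerA mulrC -scalerA cv scaler0.
have xinj : injective (scale_map A x).
  apply: linear_inj => y; have [r ->] := vgen y; rewrite /= scalerA.
  by move=> /in_elt_annihilator/pv.2/orP[/xv//|/in_elt_annihilator].
have H0 (w : H i (quotmod (immod (scale_map A x)))) : w = 0.
  apply: (IH (adjoin (elt_annihilator v) x)).
  - apply: (dim_lt_prime pv Iv (@subset_adjoin _ _ _ _) _ Ii) => sub.
    exact/xv/sub/mem_adjoin.
  - apply: (fg_image (@quotmod_surj _ _ _)); exists [:: v] => y.
    have [r ->] := vgen y; apply/spanmod_cons; exists r, 0.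
    by rewrite addr0 rpred0.
  - move=> c q /in_adjoin[r [s [/in_elt_annihilator sv cE]]].
    have {}cE : c = r * x + (s : R) := cE.
    have [y <-] := quotmod_surj q; have [t ->] := vgen y.
    rewrite -linearZ; apply/quotmod_eq0/in_immod; exists ((r * t) *: v).
    rewrite cE /= scalerDl !scalerA.
    rewrite [s * t]mulrC -[(t * s) *: v]scalerA sv scaler0 addr0.
    by rewrite [r * x]mulrC mulrA.
have [n xn] := derived_torsion_torsion z xa.
elim: n xn => [|n IHn]; first by rewrite expr0 scale1r.
rewrite exprS -scalerA => xn; apply: IHn.
apply: (satellite_inj (F := H i) (short_exact_im xinj) H0).
by rewrite (fmap_scale (c := x)).
Qed.

(** Factor f through its image: the kernel of A -> im f has no cohomology in
degree d + 1, and the cokernel of f has none in degree d. *)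
Lemma derived_torsion_right_exact d I b A B (f : {linear A -> B}) :
  dim_lt I d.+1 -> dim_lt b d -> finitely_generated A -> finitely_generated B ->
  killed_by I A -> (forall (c : R) y, c \in b -> exists x, f x = c *: y) ->
  forall z : H d B, exists x, fmap (H d) f x = z.
Proof.
move=> Id bd Afg Bfg IA fb z.
have [g gsurj gE] := image_factorization f.
have quot0 (w : H d (quotmod (immod f))) : w = 0.
  apply: (derived_torsion_vanish bd (fg_image (@quotmod_surj _ _ _) Bfg)) => c q cb.
  have [y <-] := quotmod_surj q; rewrite -linearZ; apply/quotmod_eq0/in_immod.
  exact: fb.
have [y yz] := fmap_exact (short_exact_submod (immod f)) (quot0 (fmap _ _ z)).
have ker0 (w : satellite (H d) (submod_of (kermod g))) : w = 0.
  apply: (@derived_torsion_vanish d.+1 I _ Id (fg_submod RN _ Afg)) => c x cI.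
  by apply: val_inj; rewrite /= IA.
have [x xy] := satellite_surj (short_exact_ker gsurj) ker0 y.
exists x; rewrite -yz -xy.
by rewrite (fmap_comp (f := g) (g := submod_val (immod f))).
Qed.

Lemma derived_torsion_scale_surj d I V (c : R) :
  dim_lt I d.+1 -> finitely_generated V -> killed_by I V ->
  (forall p, top_prime I d p -> c \notin p) ->
  forall z : H d V, exists y, c *: y = z.
Proof.
move=> Id Vfg IV cp z.
have [|r y|y yz] := derived_torsion_right_exact (f := scale_map V c)
  (b := adjoin I c) Id _ Vfg Vfg IV _ z.
- apply: (dim_lt_avoid Id (@subset_adjoin _ _ _ _)) => p /cp/negP + sub.
  by apply; apply/sub/mem_adjoin.
- move=> /in_adjoin[s [t [tI rE]]]; exists (s *: y).
  have {}rE : r = s * c + (t : R) := rE.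
  by rewrite rE /= scalerDl [t *: y]IV // addr0 !scalerA mulrC.
- by exists y; rewrite -yz (fmap_scale (c := c)).
Qed.

End Vanishing.

(** * Minimal primes of an ideal *)

Section MinimalPrimes.
Context (R : comNzRingType) (RN : noetherian R).
Implicit Types (I J p q : ideal R) (V : lmodType R).

Definition minimal_prime I p :=
  [/\ prime_ideal p, {subset I <= p} &
      forall q, prime_ideal q -> {subset I <= q} -> {subset q <= p} -> p = q].

Lemma prime_idealM p (x y : R) : prime_ideal p -> x * y \in p -> x \in p \/ y \in p.
Proof. by case=> _ pp /pp/orP. Qed.

Lemma prime_idealX p (x : R) n : prime_ideal p -> x ^+ n \in p -> x \in p.
Proof.
move=> pp; elim: n => [|n IH]; first by rewrite expr0 => /(negP pp.1).
by rewrite exprS => /(prime_idealM pp)[].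
Qed.

Lemma adjoin_sub I J (x : R) : {subset I <= J} -> x \in J -> {subset adjoin I x <= J}.
Proof.
move=> IJ xJ y /in_adjoin[c [z [/IJ zJ ->]]].
by apply: idealD => //; exact: ideal_mulr_closed.
Qed.

Lemma minimal_prime_adjoin I p (x : R) : minimal_prime I p -> x \in p ->
  minimal_prime (adjoin I x) p.
Proof.
move=> [pp Ip pmin] xp; split=> //; first exact: adjoin_sub.
by move=> q qq Iq; apply: pmin => // y /(@subset_adjoin _ _ I x)/Iq.
Qed.

(** Noetherian induction: if x y is in I, each prime minimal over I is minimal
over I + (x) or over I + (y). *)
Lemma minimal_primes_finite I : finite_set (minimal_prime I).
Proof.
elim/(ideal_ind RN): I => I IH.
have [I1|I1] := boolP ((1 : R) \in I).
  apply: sub_finite_set (finite_set0 _) => p [[p1 _] Ip _].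
  by rewrite Ip in p1.
have [pI|npI] := pselect (prime_ideal I).
  by apply: sub_finite_set (finite_set1 I) => p [_ Ip pmin]; apply: pmin.
have [x [y [xI yI xyI]]] := not_prime_factors I1 npI.
apply: (@sub_finite_set _ _ (minimal_prime (adjoin I x) `|` minimal_prime (adjoin I y))).
  move=> p mp; have [pp Ip _] := mp.
  by have [xp|yp] := prime_idealM pp (Ip _ xyI); [left|right]; apply: minimal_prime_adjoin.
by rewrite finite_setU; split; [apply: (IH _ x)|apply: (IH _ y)] => //;
  (exact: subset_adjoin || exact: mem_adjoin).
Qed.

(** An elementary form of the fact that the maximal ideal of the localization of
R/I at p is nilpotent.  Noetherian induction on I: when x y is in I, multiply
the elements obtained for I + (x) and I + (y) if p contains x and y, and
multiply the one for I + (x) by y if p contains only x. *)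
Lemma minimal_prime_separator I p : minimal_prime I p ->
  exists2 s : R, s \notin p & forall c : R, c \in p -> exists k, s * c ^+ k \in I.
Proof.
elim/(ideal_ind RN): I => I IH mp; have [pp Ip pmin] := mp.
have I1 : (1 : R) \notin I by apply/negP => /Ip; apply/negP/pp.1.
have [pI|npI] := pselect (prime_ideal I).
  exists 1; first exact: pp.1.
  by move=> c cp; exists 1%N; rewrite mul1r expr1 -(pmin I).
have [x [y [xI yI xyI]]] := not_prime_factors I1 npI.
wlog xp : x y xI yI xyI / x \in p.
  by move=> W; have [xp|yp] := prime_idealM pp (Ip _ xyI);
    [apply: (W x y)|apply: (W y x)] => //; rewrite mulrC.
have [s sp sI] := IH _ _ (@subset_adjoin _ _ I x) (mem_adjoin _ _) xI (minimal_prime_adjoin mp xp).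
have [yp|yp] := boolP (y \in p); last first.
  exists (s * y); first by apply/negP => /(prime_idealM pp)[]; apply/negP.
  move=> c /sI[k /in_adjoin[r [z [zI kE]]]]; exists k.
  have -> : s * y * c ^+ k = r * (x * y) + y * z.
    have {}kE : s * c ^+ k = r * x + z := kE.
    by rewrite mulrAC kE mulrDl mulrA [z * y]mulrC.
  by apply: idealD; exact: ideal_mulr_closed.
have [t tp tI] := IH _ _ (@subset_adjoin _ _ I y) (mem_adjoin _ _) yI (minimal_prime_adjoin mp yp).
exists (s * t); first by apply/negP => /(prime_idealM pp)[]; apply/negP.
move=> c cp; have [k /in_adjoin[r [z [zI kE]]]] := sI c cp.
have [l /in_adjoin[r' [z' [zI' lE]]]] := tI c cp; exists (k + l)%N.
have {}kE : s * c ^+ k = r * x + z := kE.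
have {}lE : t * c ^+ l = r' * y + z' := lE.
have -> : s * t * c ^+ (k + l) = (r * r') * (x * y) + ((t * c ^+ l) * z + (r * x) * z').
  rewrite exprD mulrACA kE lE mulrDl !mulrDr !mulrDl -!addrA; congr (_ + _).
    by rewrite mulrACA.
  rewrite addrC -!addrA; congr (_ + _); first by rewrite mulrC.
  by rewrite [z * z']mulrC.
by apply: idealD; [|apply: idealD]; exact: ideal_mulr_closed.
Qed.

(** Suitable powers of the elements given by [minimal_prime_separator]: as t_i
lies in p_j for j <> i, the product of t_i with a power of t_j is in I. *)
Lemma separators I n (p : 'I_n -> ideal R) : injective p ->
  (forall i, minimal_prime I (p i)) ->
  exists s : 'I_n -> R, [/\ forall i, s i \notin p i,
    forall i (c : R), c \in p i -> exists k, s i * c ^+ k \in I &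
    forall i j, i != j -> s i * s j \in I].
Proof.
move=> pinj pmin.
have /choice[t tP] i : exists t : R, t \notin p i /\
    forall c : R, c \in p i -> exists k, t * c ^+ k \in I.
  by have [t] := minimal_prime_separator (pmin i); exists t.
have tj i j : i != j -> t i \in p j.
  move=> ij; have [pp Ip pm] := pmin j; have [pi Ii _] := pmin i.
  have [sub|/existsNP[c /not_implyP[ci cj]]] := pselect (forall c, c \in p i -> c \in p j).
    by move: ij; rewrite (pinj _ _ (pm _ pi Ii sub)) eqxx.
  have [k /Ip/(prime_idealM pp)[//|/(prime_idealX pp)//]] := (tP i).2 c ci.
have /choice[k kP] (ij : 'I_n * 'I_n) : exists k, ij.1 != ij.2 ->
    t ij.1 * t ij.2 ^+ k \in I.
  have [e|ji] := eqVneq ij.1 ij.2; first by exists 0%N.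
  have ij' : ij.2 != ij.1 by rewrite eq_sym.
  by have [k kI] := (tP ij.1).2 _ (tj _ _ ij'); exists k.
pose K := \max_ij k ij.
exists (fun i => t i ^+ K.+1); split=> [i|i c /(tP i).2[l lI]|i j ij].
- by apply/negP => /(prime_idealX (let: And3 h _ _ := pmin i in h)); apply/negP/(tP i).1.
- by exists l; rewrite exprSr -mulrA; exact: ideal_mulr_closed.
- have /subnK kK : (k (i, j) <= K.+1)%N by apply: leqW; exact: leq_bigmax.
  have -> : t i ^+ K.+1 * t j ^+ K.+1 =
      (t i ^+ K * t j ^+ (K.+1 - k (i, j))) * (t i * t j ^+ k (i, j)).
    by rewrite mulrACA -exprSr -exprD kK.
  apply: ideal_mulr_closed.
  exact: (kP (i, j)).
Qed.

(** With s as in [minimal_prime_separator], some s m has its annihilator inside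
p and is killed by a power of each element of p.  Among the elements with these
two properties, one whose annihilator is maximal has annihilator p. *)
Lemma minimal_prime_associated V p : finitely_generated V ->
  minimal_prime (annihilator V) p -> Ass V p.
Proof.
move=> [g gP] mp; have [s sp sI] := minimal_prime_separator mp.
have [pp Ip _] := mp; split=> //.
have [m mP] : exists m : V, forall r : R, r *: (s *: m) = 0 -> r \in p.
  apply: contrapT => nm.
  have {}nm (m : V) : exists u : R, u \notin p /\ u *: (s *: m) = 0.
    apply: contrapT => nu; apply: nm; exists m => r rm.
    by apply: contrapT => /negP rp; apply: nu; exists r.
  have [u up ug] : exists2 u : R, u \notin p & {subset g <= kermod (scale_map V (u * s))}.
    elim: g {gP} => [|y g [u up ug]]; first by exists 1; [exact: pp.1|].
    have [w [wp wy]] := nm y; exists (u * w).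
      by apply/negP => /(prime_idealM pp)[]; apply/negP.
    move=> x; rewrite in_cons in_kermod /= => /orP[/eqP->|/ug/eqP/= ux].
      by rewrite -!scalerA wy scaler0.
    by rewrite [u * w]mulrC -mulrA -scalerA ux scaler0.
  have /Ip/(prime_idealM pp)[] : u * s \in annihilator V.
    by apply/in_annihilator => x; exact/eqP/(spanmod_sub ug (gP x)).
    by apply/negP.
  by apply/negP.
pose P J := exists y : V, [/\ J = elt_annihilator y, {subset J <= p} &
  forall c : R, c \in p -> exists k, c ^+ k *: y = 0].
have [|J [[y [JE Jp ynil]] Jmax]] := @ideal_maximal _ RN P.
  exists (elt_annihilator (s *: m)), (s *: m); split=> // [r /in_elt_annihilator/mP//|c].
  by move=> /sI[k /in_annihilator kI]; exists k; rewrite scalerA mulrC kI.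
exists y; apply: submod_eq => c; apply/idP/idP; last by rewrite -JE => /Jp.
move=> cp; apply/in_elt_annihilator; apply: contrapT => cy.
(* If c y were nonzero, let c^l y be the last nonzero one: either c^l y or u y,
   for some u outside p, would have a larger annihilator than y. *)
have [k /eqP ck k_min] := ex_minnP (let: ex_intro k kP := ynil c cp in
  ex_intro (fun k => c ^+ k *: y == 0) k (introT eqP kP)).
case: k ck k_min => [|l] ck k_min.
  case/negP: pp.1; apply: Jp; rewrite JE; apply/in_elt_annihilator.
  by rewrite -(expr0 c).
have cl : c ^+ l *: y <> 0 by move=> /eqP/k_min; rewrite ltnn.
have znil (b : R) d : d \in p -> exists j, (d : R) ^+ j *: (b *: y) = 0.
  by move=> /ynil[j jy]; exists j; rewrite scalerA mulrC -scalerA jy scaler0.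
have zsub (b : R) : {subset J <= elt_annihilator (b *: y)}.
  move=> r; rewrite JE => /in_elt_annihilator ry; apply/in_elt_annihilator.
  by rewrite scalerA mulrC -scalerA ry scaler0.
have zmax (b : R) : {subset elt_annihilator (b *: y) <= p} ->
    {subset elt_annihilator (b *: y) <= J}.
  by move=> bp; apply: Jmax (zsub b); exists (b *: y); split=> // d; exact: znil.
have [zp|/existsNP[u /not_implyP[/in_elt_annihilator uz /negP up]]] :=
    pselect (forall r, r \in elt_annihilator (c ^+ l *: y) -> r \in p).
  suff /in_elt_annihilator/cy : c \in elt_annihilator y by [].
  rewrite -JE; apply: (zmax _ zp).
  by apply/in_elt_annihilator; rewrite scalerA -exprS.
suff /in_elt_annihilator/cl : c ^+ l \in elt_annihilator y by [].
rewrite -JE; apply: (zmax u).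
  move=> r /in_elt_annihilator ruy.
  have : (r : R) * u \in J by rewrite JE; apply/in_elt_annihilator; rewrite -scalerA.
  by move=> /Jp/(prime_idealM pp)[//|]; rewrite (negPf up).
by apply/in_elt_annihilator; rewrite scalerA mulrC -scalerA.
Qed.

(** The localization of V at p is nonzero.  Add the generators of V one at a
time until the submodule W obtained fills V locally at p; the last generator y
generates V/W locally, so t V is contained in W + R y for some t outside p, and
mapping x to the coefficient of y in t x is well defined modulo p. *)
Lemma nonzero_map_to_prime_quotient V p : finitely_generated V -> prime_ideal p ->
  {subset annihilator V <= p} ->
  exists (f : {linear V -> quotmod p}) (y : V) (t : R),
    t \notin p /\ f y = quotmod_pi p t.
Proof.
move=> [g gP] pp Ip.
have : ~ exists2 t : R, t \notin p & forall x : V, t *: x \in zeromod V.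
  move=> [t /negP tp tV]; apply/tp/Ip/asboolP => x; apply/eqP; exact: tV.
have : forall x : V, exists w u, [/\ w \in zeromod V, u \in spanmod [set` g] & x = w + u].
  by move=> x; exists 0, x; rewrite add0r rpred0.
elim: g (zeromod V) {gP} => [|y g IH] W VW nW.
  case: nW; exists 1; first exact: pp.1.
  move=> x; have [w [u [wW]]] := VW x.
  by rewrite spanmod_nil => /eqP-> ->; rewrite addr0 scale1r.
have [[t tp tV]|nW'] := pselect (exists2 t : R, t \notin p & forall x : V, t *: x \in adjoin W y);
  last first.
  apply: (IH (adjoin W y)) nW' => x; have [w [u [wW /spanmod_cons[c [z [zg ->]]] ->]]] := VW x.
  exists (c *: y + w), z; split=> //; last by rewrite addrCA addrA.
  by apply/in_adjoin; exists c, w.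
have yW (r : R) : r *: y \in W -> r \in p.
  move=> ryW; apply: contrapT => /negP rp; apply: nW; exists (r * t).
    by apply/negP => /(prime_idealM pp)[]; apply/negP.
  move=> x; have /in_adjoin[c [z [zW tx]]] := tV x.
  rewrite -scalerA tx scalerDr scalerA mulrC -scalerA.
  by apply: rpredD; apply: rpredZ.
have /choice[h hP] (x : V) : exists r : R, t *: x - r *: y \in W.
  by have /in_adjoin[c [z [zW ->]]] := tV x; exists c; rewrite addrAC subrr add0r.
have hE (x : V) (r : R) : t *: x - r *: y \in W -> quotmod_pi p (h x) = quotmod_pi p r.
  move=> rW; apply/quotmod_piP; apply: (yW (h x - r)).
  have -> : (h x - r) *: y = (t *: x - r *: y) - (t *: x - h x *: y).
    by rewrite scalerBl opprB [RHS]addrC addrA subrK.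
  exact: rpredB.
have lin : linear (fun x => quotmod_pi p (h x)).
  move=> c x x'; rewrite -linearP; apply: hE.
  have -> : (c *: (h x : R^o) + h x' : R^o) = (c * h x + h x' : R) by [].
  rewrite scalerDr scalerDl opprD addrACA scalerA mulrC -!scalerA -scalerBr.
  by rewrite rpredD ?rpredZ.
by exists (mklin lin), y, t; split=> //=; apply: hE; rewrite subrr rpred0.
Qed.

End MinimalPrimes.

(** * Secondary modules *)

Section Secondary.
Context (R : comNzRingType).
Implicit Types (I p q : ideal R) (V Q : lmodType R).

Lemma in_radical I (c : R) : c \in radical I <-> exists n, c ^+ n \in I.
Proof. by split=> [/asboolP//|?]; apply/asboolP. Qed.

Lemma in_sum_submod V n (P : pred 'I_n) (S : 'I_n -> submod V) x :
  x \in sum_submod P S <->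
  exists2 y : 'I_n -> V, forall i, P i -> y i \in S i & x = \sum_(i | P i) y i.
Proof.
split=> [/asboolP xS|[y yS ->]]; last first.
  rewrite rpred_sum // => i Pi; apply/asboolP => W; apply; exists i => //.
  exact: yS.
have Wcl : submod_closed [pred x : V | `[< exists2 y : 'I_n -> V,
    forall i, P i -> y i \in S i & x = \sum_(i | P i) y i >]].
  split=> [|c u v /asboolP[y yS ->] /asboolP[z zS ->]]; apply/asboolP.
    by exists (fun=> 0) => [i _|]; rewrite ?rpred0 ?big1.
  exists (fun i => c *: y i + z i) => [i Pi|].
    by rewrite rpredD ?rpredZ ?yS ?zS.
  by rewrite scaler_sumr big_split.
apply/asboolP; apply: (xS (Submod Wcl)) => z [i Pi zS]; apply/asboolP.
exists (fun j => if j == i then z else 0) => [j _|].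
  by case: eqP => [->|_]; [exact: zS|exact: rpred0].
rewrite (bigD1 i) //= eqxx big1 ?addr0 // => j /andP[_ /negPf->].
by [].
Qed.

(** For W nonzero this says that W is secondary with attached prime q. *)
Definition secondary_or_zero V q (W : submod V) :=
  (forall c : R, c \in q -> exists k, forall x, x \in W -> c ^+ k *: x = 0) /\
  (forall (c : R) x, c \notin q -> x \in W -> exists2 y, y \in W & c *: y = x).

Lemma secondary_or_zero_iter V q (W : submod V) (c : R) k x : secondary_or_zero q W ->
  c \notin q -> x \in W -> exists2 y, y \in W & c ^+ k *: y = x.
Proof.
move=> [_ sW] cq; elim: k x => [|k IH] x xW; first by exists x; rewrite ?expr0 ?scale1r.
have [y yW <-] := sW c x cq xW; have [z zW <-] := IH y yW.
by exists z; rewrite // scalerA -exprS.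
Qed.

Lemma attached_primeE V q (W : submod V) x : secondary_or_zero q W ->
  x \in W -> x != 0 -> attached_prime W = q.
Proof.
move=> sW xW x0; apply: submod_eq => c; apply/idP/idP.
  move=> /in_radical[k /in_annihilator ck]; apply: contrapT => /negP cq.
  have [y yW yx] := secondary_or_zero_iter k sW cq xW.
  by case/eqP: x0; rewrite -yx; have := congr1 val (ck (Sub y yW)).
move=> /sW.1[k ck]; apply/in_radical; exists k; apply/in_annihilator => y.
by apply: val_inj; apply: ck; exact: valP.
Qed.

Lemma secondary_or_zero_secondary V q (W : submod V) x : secondary_or_zero q W ->
  x \in W -> x != 0 -> secondary (submod_of W).
Proof.
move=> [nW sW] xW x0; split.
  by exists (Sub x xW); apply: contra_neq x0 => /(congr1 val).
move=> c; have [/nW[k ck]|cq] := boolP (c \in q); [right|left].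
  by exists k => y; apply: val_inj; apply: ck; exact: valP.
move=> y; have [z zW zy] := sW c (val y) cq (valP y).
by exists (Sub z zW); apply: val_inj.
Qed.

Lemma secondary_attached V (W : submod V) : secondary (submod_of W) ->
  prime_ideal (attached_prime W) /\ secondary_or_zero (attached_prime W) W.
Proof.
move=> [[x0 x00] sW].
have surj (c : R) : c \notin attached_prime W ->
    forall y : submod_of W, exists x, c *: x = y.
  move=> /negP cW; have [//|[n cn]] := sW c; case: cW.
  by apply/in_radical; exists n; apply/in_annihilator.
have surjX (c : R) n : (forall y : submod_of W, exists x, c *: x = y) ->
    forall y : submod_of W, exists x, c ^+ n *: x = y.
  move=> cs; elim: n => [|n IH] y; first by exists y; rewrite expr0 scale1r.
  have [z <-] := cs y; have [u <-] := IH z.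
  by exists u; rewrite scalerA -exprS.
have nsurj (c : R) : (forall y : submod_of W, exists x, c *: x = y) ->
    c \notin attached_prime W.
  move=> cs; apply/negP => /in_radical[n /in_annihilator cn].
  by case/eqP: x00; have [y <-] := surjX c n cs x0.
split; last first.
  split=> [c /in_radical[k /in_annihilator ck]|c x /surj cs xW].
    by exists k => x xW; have := congr1 val (ck (Sub x xW)).
  have [y yx] := cs (Sub x xW); exists (val y); first exact: valP.
  by have := congr1 val yx.
split; first by apply: nsurj => y; exists y; rewrite scale1r.
move=> c d cd; apply: contrapT => /negP; rewrite negb_or => /andP[/surj cs /surj ds].
have /negP[] // : (c * d : R) \notin attached_prime W.
apply: nsurj => y; have [z <-] := cs y; have [u <-] := ds z.
by exists u; rewrite scalerA.
Qed.

Lemma finite_exponent n (P : 'I_n -> nat -> Prop) :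
  (forall i k l, (k <= l)%N -> P i k -> P i l) ->
  (forall i, exists k, P i k) -> exists k, forall i, P i k.
Proof.
move=> mono /choice[k kP]; exists (\max_i k i) => i.
exact: mono (leq_bigmax i) (kP i).
Qed.

(** The elements nilpotent on Q are those that lie in q_i for every i such that
S_i has nonzero image.  So p is the intersection of these finitely many q_i;
being prime, it equals one of them. *)
Lemma secondary_quotient V Q n (f : {linear V -> Q}) (p : ideal R)
    (q : 'I_n -> ideal R) (S : 'I_n -> submod V) :
  (forall y : Q, exists x, f x = y) -> prime_ideal p ->
  (forall c : R, c \in p <-> exists k, forall y : Q, c ^+ k *: y = 0) ->
  (forall x, x \in sum_submod predT S) ->
  (forall i, secondary_or_zero (q i) (S i)) ->
  exists i, p = q i /\ exists2 x, x \in S i & f x != 0.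
Proof.
move=> fs pp pnil Ssum sS.
pose B i := exists2 x, x \in S i & f x != 0.
have pB (c : R) : c \in p <-> forall i, B i -> c \in q i.
  rewrite pnil; split=> [[k ck] i [x xS fx]|cB].
    apply: contrapT => /negP cq; have [y yS yx] := secondary_or_zero_iter k (sS i) cq xS.
    by case/eqP: fx; rewrite -yx linearZ_LR ck.
  have [|i|k kP] := @finite_exponent n (fun i k => forall x, x \in S i -> c ^+ k *: f x = 0).
  - by move=> i k l /subnK <- ck x xS; rewrite exprD -scalerA ck ?scaler0.
  - have [/cB/(sS i).1[k ck]|nB] := pselect (B i).
      by exists k => x xS; rewrite -linearZ_LR ck ?linear0.
    exists 0%N => x xS; rewrite expr0 scale1r; apply/eqP.
    by apply: contrapT => /negP fx; apply: nB; exists x.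
  - exists k => y; have [x <-] := fs y.
    have /in_sum_submod[z zS ->] := Ssum x.
    by rewrite linear_sum scaler_sumr big1 // => i _; apply: (kP i); exact: zS.
apply: contrapT => nB.
have /choice[c cP] i : exists c : R, B i -> c \in q i /\ c \notin p.
  have [Bi|nBi] := pselect (B i); last by exists 0.
  have [sub|/existsNP[c /not_implyP[cq /negP cp]]] := pselect (forall c : R, c \in q i -> c \in p).
    case: nB; exists i; split=> //; apply: submod_eq => c.
    by apply/idP/idP => [/pB/(_ i Bi)|/sub].
  by exists c.
pose D := [pred i | `[< B i >]].
have : \prod_(i | D i) c i \in p.
  apply/pB => i Bi; rewrite (bigD1 i) /=; last exact/asboolP.
  by rewrite mulrC; apply: ideal_mulr_closed; have [] := cP i Bi.
elim/big_rec: _ => [|i x /asboolP /cP[_ ci] IH /(prime_idealM pp)[]//].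
  exact/negP/pp.1.
exact/negP.
Qed.

(** A set A of indices, minimal among those for which the S_i with i in A still
span, discards the zero submodules together with the redundant ones. *)
Lemma minimal_representation_exists V n (p : 'I_n -> ideal R) (S : 'I_n -> submod V) :
  injective p -> (forall i, secondary_or_zero (p i) (S i)) ->
  (forall x, x \in sum_submod predT S) ->
  exists m (S' : 'I_m -> submod V), minimal_secondary_representation S'.
Proof.
move=> pinj sS Ssum.
pose P (A : {set 'I_n}) := `[< forall x, x \in sum_submod (mem A) S >].
have PT : P [set: 'I_n]%SET.
  apply/asboolP => x; have /in_sum_submod[y yS ->] := Ssum x.
  by apply/in_sum_submod; exists y => [i _|]; [exact: yS|apply: eq_bigl => i; rewrite !inE].
have [A /minsetP[/asboolP PA Amin]] := ex_minset (ex_intro P _ PT).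
have Airr i : i \in A -> ~ {subset S i <= sum_submod [pred j in A | j != i] S}.
  move=> iA Si; have : (A :\ i)%SET = A.
    apply: Amin; last exact: subD1set.
    apply/asboolP => x; have /in_sum_submod[y yS ->] := PA x.
    rewrite (bigD1 i); last exact: iA.
    apply: rpredD.
      have /in_sum_submod[z zS ->] := Si _ (yS i iA).
      apply/in_sum_submod; exists z; last by apply: eq_bigl => j; rewrite !inE andbC.
      by move=> j; rewrite !inE => /andP[ji jA]; apply: zS; rewrite inE jA.
    apply/in_sum_submod; exists y; last by apply: eq_bigl => j; rewrite !inE andbC.
    by move=> j; rewrite !inE => /andP[_ jA]; apply: yS.
  by move=> AE; move: iA; rewrite -AE !inE eqxx.
have Snz i : i \in A -> exists2 x, x \in S i & x != 0.
  move=> iA; apply: contrapT => Si0; apply: (Airr i iA) => x xS.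
  suff -> : x = 0 by exact: rpred0.
  by apply/eqP; apply: contrapT => /negP x0; apply: Si0; exists x.
pose e (j : 'I_#|A|) := enum_val j.
exists #|A|, (S \o e); split=> /=.
- move=> j; have [x xS x0] := Snz _ (enum_valP j).
  exact: secondary_or_zero_secondary (sS _) xS x0.
- move=> x; have /in_sum_submod[y yS ->] := PA x.
  apply/in_sum_submod; exists (y \o e) => [j _|]; first exact: yS (enum_valP j).
  exact: (big_enum_val y).
- move=> j k jk; apply: enum_val_inj; apply: pinj.
  have [x xS x0] := Snz _ (enum_valP j); have [y yS y0] := Snz _ (enum_valP k).
  by rewrite -(attached_primeE (sS _) xS x0) -(attached_primeE (sS _) yS y0).
- move=> j Sj; apply: (Airr _ (enum_valP j)) => x /Sj/in_sum_submod[y yS ->].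
  apply: rpred_sum => k kj; apply/in_sum_submod.
  exists (fun i => if i == e k then y k else 0) => [i /andP[iA ij]|].
    by case: eqP => [->|_]; [exact: yS|exact: rpred0].
  rewrite (bigD1 (e k)) /=; last first.
    by rewrite (enum_valP k) (inj_eq enum_val_inj).
  by rewrite eqxx big1 ?addr0 // => i /andP[_ /negPf->].
Qed.

(** The elements s_i play the part of orthogonal idempotents: a sum of multiples
c_j s_j with each c_j outside p_j avoids every prime p_i, because s_j lies in
p_i for j <> i. *)
Lemma separated_secondary I V n (p : 'I_n -> ideal R) (s : 'I_n -> R) :
  killed_by I V -> (forall i, prime_ideal (p i)) -> (forall i, s i \notin p i) ->
  (forall i (c : R), c \in p i -> exists k, s i * c ^+ k \in I) ->
  (forall i j, i != j -> s i * s j \in I) ->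
  (forall i, {subset I <= p i}) ->
  (forall c : R, (forall i, c \notin p i) -> forall z : V, exists y, c *: y = z) ->
  (forall i, secondary_or_zero (p i) (immod (scale_map V (s i)))) /\
  forall x, x \in sum_submod predT (fun i => immod (scale_map V (s i))).
Proof.
move=> IV pp sp snil sorth Ip surj.
have sj i j : i != j -> s i \in p j.
  by move=> /sorth/Ip/(prime_idealM (pp j))[]//; rewrite (negPf (sp j)).
have avoid (c : 'I_n -> R) : (forall i, c i \notin p i) ->
    forall i, \sum_j c j * s j \notin p i.
  move=> cp i; rewrite (bigD1 i) //=; apply/negP => sum_in.
  have : c i * s i \in p i.
    rewrite -[_ * _](addrK (\sum_(j | j != i) c j * s j)); apply: idealB => //.
    apply: (@rpred_sum R^o (p i)) => j ji; apply: ideal_mulr_closed; exact: sj.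
  by move=> /(prime_idealM (pp i))[]; apply/negP.
split; last first.
  move=> x; have [|y <-] := surj (\sum_j 1 * s j) _ x.
    by apply: avoid => i; exact: (pp i).1.
  apply/in_sum_submod; exists (fun i => s i *: y) => [i _|].
    by apply/in_immod; exists y.
  by rewrite scaler_suml; apply: eq_bigr => i _; rewrite mul1r.
move=> i; split=> [c /snil[k ck]|c x cp /in_immod[y <-]].
  by exists k => x /in_immod[y <-]; rewrite /= scalerA mulrC IV.
have [|z <-] := surj (\sum_j (if j == i then c else 1) * s j) _ y.
  by apply: avoid => j; case: eqP => [->//|_]; exact: (pp j).1.
exists (s i *: (s i *: z)); first by apply/in_immod; exists (s i *: z).
rewrite /= (bigD1 i) //= eqxx scalerDl scalerDr !scaler_suml scaler_sumr big1 ?addr0.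
  by rewrite !scalerA mulrA [s i * c]mulrC.
move=> j ji; rewrite (negPf ji) mul1r scalerA.
have ij : i != j by rewrite eq_sym.
exact/IV/sorth.
Qed.

End Secondary.

(** * Top local cohomology *)

Lemma nat_supE (A : set nat) (d : nat) :
  nat_sup A = d%:E%E <-> A d /\ forall m, A m -> (m <= d)%N.
Proof.
rewrite /nat_sup; case: asboolP => [->|A0]; first by split=> [|[]].
split=> [|[Ad Amax]].
  by case: xgetP => [x _ [n [An nmax] <-] [<-]|].
case: xgetP => [x _ [n [An nmax] <-]|none]; last first.
  by case: (none d%:E%E); exists d.
by congr EFin; apply/eqP; rewrite eqn_leq Amax ?nmax.
Qed.

Section TopLocalCohomology.
Context (R : comNzRingType) (RN : noetherian R) (a : ideal R) (d : nat).
Implicit Types (I p q : ideal R) (V : lmodType R).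

Local Notation H := (derived_torsion a d).

Lemma quotmod_generates p : generates (quotmod_pi p (1 : R^o)).
Proof.
move=> x; have [r <-] := quotmod_surj x; exists r.
by rewrite -linearZ_LR; congr (quotmod_pi p _); rewrite -[RHS]/(r * 1) mulr1.
Qed.

Lemma quotmod_fg p : finitely_generated (quotmod p).
Proof.
exists [:: quotmod_pi p (1 : R^o)] => x; have [r ->] := quotmod_generates x.
by apply/spanmod_cons; exists r, 0; rewrite addr0 rpred0.
Qed.

Lemma quotmod_killed p : killed_by p (quotmod p).
Proof.
move=> c x cp; have [r <-] := quotmod_surj x; rewrite -linearZ_LR.
by apply/quotmod_eq0; rewrite -[c *: _]/(c * (r : R)) mulrC; exact: ideal_mulr_closed.
Qed.

Lemma top_prime_self I p q : dim_lt I d.+1 -> top_prime I d p ->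
  top_prime p d q -> q = p.
Proof.
move=> Id [pp Ip pd] [qq pq qd]; apply: (top_prime_minimal Id) => //.
by split=> // x /Ip/pq.
Qed.

Lemma prime_quotient_scale_surj I p (c : R) : dim_lt I d.+1 -> top_prime I d p ->
  c \notin p -> forall z : H (quotmod p), exists y, c *: y = z.
Proof.
move=> Id ptop cp; have [_ Ip _] := ptop.
apply: (derived_torsion_scale_surj RN (dim_lt_sub Ip Id) (quotmod_fg p) (@quotmod_killed p)).
by move=> q /(top_prime_self Id ptop) ->.
Qed.

Lemma functor_killed (F : half_exact_functor R) V (c : R) : (forall x : V, c *: x = 0) ->
  forall z : F V, c *: z = 0.
Proof.
by move=> cV z; rewrite -(fmap_scale (f := scale_map V c)) // fmap0.
Qed.

Lemma prime_quotient_nilpotent I p : dim_lt I d.+1 -> top_prime I d p ->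
  (exists z : H (quotmod p), z != 0) ->
  forall c : R, c \in p <-> exists k, forall z : H (quotmod p), c ^+ k *: z = 0.
Proof.
move=> Id ptop [z z0] c; split=> [cp|[k ck]].
  exists 1%N => y; rewrite expr1; apply: functor_killed => x.
  exact: quotmod_killed.
apply: contrapT => /negP cp; have [pp _ _] := ptop.
have ckp : c ^+ k \notin p by apply/negP => /(prime_idealX pp); apply/negP.
have [y yz] := prime_quotient_scale_surj Id ptop ckp z.
by case/eqP: z0; rewrite -yz ck.
Qed.

(** The cokernel of the map given by [nonzero_map_to_prime_quotient] is killed by
p and by t outside p, so it has dimension less than d. *)
Lemma top_cohomology_onto_prime_quotient V p : dim_lt (annihilator V) d.+1 ->
  finitely_generated V -> top_prime (annihilator V) d p ->
  exists f : {linear H V -> H (quotmod p)}, forall z, exists y, f y = z.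
Proof.
move=> Id Vfg ptop; have [pp Ip pd] := ptop.
have [f [y [t [tp fy]]]] := nonzero_map_to_prime_quotient Vfg pp Ip.
exists (fmap H f); apply: (derived_torsion_right_exact RN (b := adjoin p t) Id) => //.
- apply: (dim_lt_prime pp (fun x => id) (@subset_adjoin _ _ _ _) _ (dim_lt_sub Ip Id)) => sub.
  by case/negP: tp; exact/sub/mem_adjoin.
- exact: quotmod_fg.
- by move=> c x /in_annihilator.
move=> c z /in_adjoin[r [u [up cE]]]; have [w <-] := quotmod_surj z.
exists ((r * (w : R)) *: y); rewrite linearZ_LR fy -!linearZ_LR.
apply/quotmod_piP.
have {}cE : c = r * t + (u : R) := cE.
rewrite -[_ - _]/((r * (w : R)) * t - c * (w : R) : R) cE mulrDl opprD addrA.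
rewrite [r * t * w]mulrAC subrr; apply: idealB; first exact: ideal0.
by rewrite mulrC; exact: ideal_mulr_closed.
Qed.

(** Multiplication by s on the cohomology of V factors through that of s V.  Every
prime containing the annihilator of s V contains p, so each R/q in a prime
filtration of s V is a quotient of R/p, and right exactness shows that it has no
cohomology in degree d. *)
Lemma separator_kills_top_cohomology V p (s : R) : dim_lt (annihilator V) d.+1 ->
  finitely_generated V -> top_prime (annihilator V) d p ->
  (forall c : R, c \in p -> exists k, s * c ^+ k \in annihilator V) ->
  (forall z : H (quotmod p), z = 0) -> forall z : H V, s *: z = 0.
Proof.
move=> Id Vfg [pp Ip pd] sp Hp0 z.
pose W := immod (scale_map V s).
have [g _ gE] := image_factorization (scale_map V s).
rewrite -(fmap_scale (f := scale_map V s)) //.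
rewrite (fmap_comp (f := g) (g := submod_val W)) //.
suff W0 (y : H (submod_of W)) : y = 0 by rewrite [fmap H g z]W0 linear0.
have Wkill (c : R) (x : submod_of W) : c \in annihilator (submod_of W) -> c *: x = 0.
  by move=> /in_annihilator.
move: y; apply: (functor_devissage RN _ (fg_submod RN W Vfg) Wkill).
move=> A v vgen vp Wv y.
have pv : {subset p <= elt_annihilator v}.
  move=> c /sp[k /in_annihilator ck]; apply: (prime_idealX (n := k) vp); apply: Wv.
  apply/in_annihilator => x; apply: val_inj; have /in_immod[u uE] := valP x.
  by rewrite /= -uE /= scalerA mulrC ck.
have [|f fE] := @linear_descend _ _ _ _ (quotmod_pi p) (mulr_gen v) (@quotmod_surj _ _ p).
  by move=> r /quotmod_eq0/pv/in_elt_annihilator.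
have full_dim : dim_lt (fullmod R^o) d.
  by move=> m [c [/(_ 0%N isT)[[c1 _] full] _]]; case/negP: c1; apply: full.
have [||||x <-] := derived_torsion_right_exact RN (f := f) (I := p)
  (dim_lt_sub Ip Id) full_dim _ _ _ _ y.
- exact: quotmod_fg.
- exists [:: v] => x; have [r ->] := vgen x.
  by apply/spanmod_cons; exists r, 0; rewrite addr0 rpred0.
- exact: quotmod_killed.
- by move=> c x _; have [r ->] := vgen x; exists (quotmod_pi p (c * r : R^o)); rewrite fE scalerA.
by rewrite [x]Hp0 linear0.
Qed.

End TopLocalCohomology.

Lemma finite_enumeration (T : Type) (A : set T) : finite_set A ->
  exists n (f : 'I_n -> T), injective f /\ forall x, A x <-> exists i, f i = x.
Proof.
move=> /finite_setP[n /card_esym/card_bijP[g [h gK hK]]]; exists n.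
pose f (i : 'I_n) := g (SigSub (mem_set (ltn_ord i : `I_n i))).
exists (fun i => val (f i)); split=> [i j /val_inj/(can_inj gK)/(congr1 val) /= ij|x].
  exact: val_inj.
split=> [Ax|[i <-]]; last exact/set_mem/valP.
pose y : A := SigSub (mem_set Ax).
have hn : (val (h y) < n)%N by exact: (set_mem (valP (h y))).
exists (Ordinal hn); rewrite /f; set z := SigSub _.
by have -> : z = h y; [exact: val_inj | rewrite hK].
Qed.

Lemma dim_quotE (R : comNzRingType) (I : ideal R) d :
  dim_quot I = d%:E%E <-> prime_chain_length I d /\ dim_lt I d.+1.
Proof. exact: nat_supE. Qed.

Unset Implicit Arguments.

Theorem theorem2p5 (R : comNzRingType) (a : ideal R) (M : lmodType R) (d : nat)
    (R_noetherian : noetherian R) (M_fg : finitely_generated M)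
    (dim_M : dim_module M = d%:E%E) :
  Att (local_cohomology a d M) =
    [set p : ideal R | Assh M p /\
       cohomological_dimension a (quotmod p) = d%:E%E].
Proof.
have [Id_chain Id] := iffLR (dim_quotE _ _) dim_M.
set I := annihilator M in Id Id_chain.
have top_min p : top_prime I d p -> minimal_prime I p.
  move=> ptop; have [pp Ip _] := ptop; split=> // q qq Iq qp.
  exact: top_prime_minimal Id ptop qq Iq qp.
have [n [p [pinj ptopP]]] := finite_enumeration
  (sub_finite_set top_min (minimal_primes_finite R_noetherian I)).
have ptop i : top_prime I d (p i) by apply/ptopP; exists i.
have [s [sp snil sorth]] := separators R_noetherian pinj (fun i => top_min _ (ptop i)).
set L := local_cohomology a d M.
have [h [hinj hsurj]] := local_cohomology_iso a d M.
have [k hk] := linear_corestrict (h := idfun) hinj hsurj.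
have kh x : k (h x) = x by apply: hinj; rewrite hk.
have IL : killed_by I L.
  move=> c z cI; rewrite -[z]hk -linearZ_LR functor_killed ?linear0 //.
  exact/in_annihilator.
have [|||sS ssum] := separated_secondary (V := L) (p := p) IL _ sp snil sorth.
- by move=> i; have [] := ptop i.
- by move=> i; have [] := ptop i.
- move=> c cp z; have [||x xz] :=
    derived_torsion_scale_surj (a := a) (c := c) R_noetherian Id M_fg _ _ (k z).
  - by move=> b x /in_annihilator.
  - by move=> q /ptopP[i <-].
  by exists (h x); rewrite -linearZ_LR xz hk.
apply/seteqP; split=> q.
  (* An attached prime: compare T(M) = sum of the s_i T(M) with its quotient by
     all the components of the given representation but the j-th. *)
  move=> [m [S [[Ssec Ssum Sinj Sirr] [j ->]]]].
  have [qp qS] := secondary_attached (Ssec j).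
  pose W := sum_submod (predC1 j) S.
  have piS (y : quotmod W) : exists2 x, x \in S j & quotmod_pi W x = y.
    have [x <-] := quotmod_surj y; have /in_sum_submod[z zS xE] := Ssum x.
    exists (z j); first exact: zS.
    apply/quotmod_piP; rewrite xE (bigD1 j) // opprD addrA subrr sub0r rpredN.
    by apply/in_sum_submod; exists z => // i _; apply: zS.
  have qnil (c : R) : c \in attached_prime (S j) <->
      exists l, forall y : quotmod W, c ^+ l *: y = 0.
    split=> [/qS.1[l cl]|[l cl]].
      by exists l => y; have [x xS <-] := piS y; rewrite -linearZ_LR cl ?linear0.
    apply: contrapT => /negP cq; apply: (Sirr j) => x xS.
    have [y yS <-] := secondary_or_zero_iter l qS cq xS.
    by apply/quotmod_eq0; rewrite linearZ_LR; exact: cl.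
  have [i [-> [x /in_immod[u ux] xW]]] := secondary_quotient
    (@quotmod_surj _ _ W) qp qnil ssum sS.
  have [pp Ip pd] := ptop i.
  have pId := dim_lt_sub Ip Id.
  have dimp : dim_quot (p i) = d%:E%E by apply/dim_quotE.
  split; first split.
  - exact (minimal_prime_associated R_noetherian M_fg (top_min _ (ptop i))).
  - by rewrite dimp dim_M.
  have [g [ginj gsurj]] := local_cohomology_iso a d (quotmod (p i)).
  apply/nat_supE; split=> [|l [z z0]].
    apply: contrapT => nz; case/eqP: xW; rewrite -ux.
    suff -> : scale_map L (s i) u = 0 by rewrite linear0.
    have kill := separator_kills_top_cohomology R_noetherian Id M_fg (ptop i) (snil i).
    rewrite -[LHS]/(s i *: u) -[u]hk -linearZ_LR kill ?linear0 //.
    move=> z; apply: contrapT => /eqP z0; apply: nz; exists (g z).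
    by apply: contra_neq z0 => gz; apply: ginj; rewrite gz linear0.
  rewrite leqNgt; apply/negP => dl; case/eqP: z0.
  have [g' [_ g'surj]] := local_cohomology_iso a l (quotmod (p i)).
  have [y <-] := g'surj z; rewrite [y](derived_torsion_vanish R_noetherian _
    (quotmod_fg _) (@quotmod_killed _ _)) ?linear0 //.
  by move=> b /pId; rewrite ltnS => bd; exact: leq_ltn_trans bd dl.
(* Conversely compare a minimal representation of T(M) with its quotient T(R/q). *)
move=> [[[qp [x qx]] dimq] cdq].
have qtop : top_prime I d q.
  split=> //; last by move: dimq; rewrite dim_M => /dim_quotE[].
  by move=> c /in_annihilator cM; rewrite qx; apply/in_elt_annihilator.
have [[z z0] _] := iffLR (nat_supE _ _) cdq.
have [g [ginj gsurj]] := local_cohomology_iso a d (quotmod q).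
have Hnz : exists y : derived_torsion a d (quotmod q), y != 0.
  have [y yz] := gsurj z; exists y; apply: contra_neq z0 => y0.
  by rewrite -yz y0 linear0.
have [f fsurj] := top_cohomology_onto_prime_quotient R_noetherian a Id M_fg qtop.
have [m [S Smin]] := minimal_representation_exists pinj sS ssum.
have [Ssec Ssum _ _] := Smin.
have [|j [qE _]] := secondary_quotient (f := f \o k) _ qp
  (prime_quotient_nilpotent R_noetherian Id qtop Hnz) Ssum
  (fun j => (secondary_attached (Ssec j)).2).
  by move=> y; have [u <-] := fsurj y; exists (h u); rewrite /= kh.
by exists m, S; split=> //; exists j.
Qed.
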